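(* Let $G$ be a countable group and $L_0$ a proper length function on $G$. Then $G$ does not have the Haagerup property if and only if $G$ has relative property T with respect to some sequence $(\mu_n)_{n\in\mathbf{N}}$ of symmetric probability measures on $G$ such that, for every $n$, $\mu_n$ is supported on a finite subset of $\{g\in G: L_0(g)\ge n\}$.
   Context: A length function on $G$ is $L:G\to\mathbf{R}_+$ with $L(1)=0$, $L(gh)\le L(g)+L(h)$, $L(g^{-1})=L(g)$; it is proper if $\{g: L(g)\le r\}$ is finite for every $r$. $G$ has the Haagerup property if it admits a metrically proper action by affine isometries on a Hilbert space. A probability measure $\mu$ on $G$ is symmetric if $\mu(g)=\mu(g^{-1})$; $\mathbf{E}_\mu(f)=\sum_g f(g)\mu(g)$. $G$ has relative property T with respect to a sequence of probability measures $(\mu_n)$ if for every sequence $(\phi_k)$ of positive definite functions on $G$ converging pointwise to $1$, one has $\mathbf{E}_{\mu_n}(\phi_k)\to 1$ as $k\to\infty$, uniformly in $n\in\mathbf{N}$. *)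

(* Defs.v *)
From Stdlib Require Import Reals List.
Open Scope R_scope.

Record is_group (G : Type) (mul : G -> G -> G) (inv : G -> G) (e : G) : Prop := {
  grp_assoc : forall x y z, mul x (mul y z) = mul (mul x y) z;
  grp_idl : forall x, mul e x = x;
  grp_idr : forall x, mul x e = x;
  grp_invl : forall x, mul (inv x) x = e;
  grp_invr : forall x, mul x (inv x) = e }.

Definition countable (G : Type) : Prop :=
  exists f : G -> nat, forall x y, f x = f y -> x = y.

Definition finite_pred {G : Type} (P : G -> Prop) : Prop :=
  exists l : list G, forall g, P g -> In g l.

Definition length_function {G : Type} (mul : G -> G -> G) (inv : G -> G) (e : G)
  (L : G -> R) : Prop :=
  (forall g, 0 <= L g) /\ L e = 0 /\
  (forall g h, L (mul g h) <= L g + L h) /\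
  (forall g, L (inv g) = L g).

Definition proper_length {G : Type} (L : G -> R) : Prop :=
  forall r : R, finite_pred (fun g => L g <= r).

Record HilbertSpace : Type := {
  hV :> Type;
  h0 : hV;
  hadd : hV -> hV -> hV;
  hopp : hV -> hV;
  hscal : R -> hV -> hV;
  hinner : hV -> hV -> R;
  h_addA : forall x y z, hadd x (hadd y z) = hadd (hadd x y) z;
  h_addC : forall x y, hadd x y = hadd y x;
  h_add0 : forall x, hadd x h0 = x;
  h_addN : forall x, hadd x (hopp x) = h0;
  h_scal1 : forall x, hscal 1 x = x;
  h_scalA : forall a b x, hscal a (hscal b x) = hscal (a * b) x;
  h_scalDr : forall a x y, hscal a (hadd x y) = hadd (hscal a x) (hscal a y);
  h_scalDl : forall a b x, hscal (a + b) x = hadd (hscal a x) (hscal b x);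
  h_innerC : forall x y, hinner x y = hinner y x;
  h_innerDl : forall x y z, hinner (hadd x y) z = hinner x z + hinner y z;
  h_innerZl : forall a x y, hinner (hscal a x) y = a * hinner x y;
  h_innerpos : forall x, 0 <= hinner x x;
  h_innerdef : forall x, hinner x x = 0 -> x = h0;
  h_complete : forall u : nat -> hV,
    (forall eps, eps > 0 -> exists N, forall m n, (m >= N)%nat -> (n >= N)%nat ->
       sqrt (hinner (hadd (u m) (hopp (u n))) (hadd (u m) (hopp (u n)))) < eps) ->
    exists l : hV, forall eps, eps > 0 -> exists N, forall n, (n >= N)%nat ->
       sqrt (hinner (hadd (u n) (hopp l)) (hadd (u n) (hopp l))) < eps }.

Definition hdist (H : HilbertSpace) (x y : H) : R :=
  sqrt (hinner H (hadd H x (hopp H y)) (hadd H x (hopp H y))).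

Definition affine_isometric_action {G : Type} (mul : G -> G -> G) (e : G)
  (H : HilbertSpace) (alpha : G -> H -> H) : Prop :=
  (forall x, alpha e x = x) /\
  (forall g h x, alpha (mul g h) x = alpha g (alpha h x)) /\
  (forall g x y, hdist H (alpha g x) (alpha g y) = hdist H x y) /\
  (forall g (a b : R) x y, a + b = 1 ->
     alpha g (hadd H (hscal H a x) (hscal H b y))
     = hadd H (hscal H a (alpha g x)) (hscal H b (alpha g y))).

Definition bounded_set (H : HilbertSpace) (B : H -> Prop) : Prop :=
  exists (x0 : H) (r : R), forall x, B x -> hdist H x x0 <= r.

Definition metrically_proper {G : Type} (H : HilbertSpace) (alpha : G -> H -> H) : Prop :=
  forall B : H -> Prop, bounded_set H B ->
    finite_pred (fun g => exists x, B x /\ B (alpha g x)).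

Definition Haagerup (G : Type) (mul : G -> G -> G) (e : G) : Prop :=
  exists (H : HilbertSpace) (alpha : G -> H -> H),
    affine_isometric_action mul e H alpha /\ metrically_proper H alpha.

Definition Cx : Type := (R * R)%type.
Definition Cadd (z w : Cx) : Cx := (fst z + fst w, snd z + snd w).
Definition Cmul (z w : Cx) : Cx :=
  (fst z * fst w - snd z * snd w, fst z * snd w + snd z * fst w).
Definition Cconj (z : Cx) : Cx := (fst z, - snd z).
Definition Cscale (a : R) (z : Cx) : Cx := (a * fst z, a * snd z).
Definition Cmod (z : Cx) : R := sqrt (fst z * fst z + snd z * snd z).
Definition Czero : Cx := (0, 0).
Definition Csum (l : list Cx) : Cx := fold_right Cadd Czero l.

Definition positive_definite {G : Type} (mul : G -> G -> G) (inv : G -> G)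
  (phi : G -> Cx) : Prop :=
  forall l : list (G * Cx),
    let s := Csum (map (fun p => Csum (map (fun q =>
               Cmul (Cmul (Cconj (snd p)) (snd q)) (phi (mul (inv (fst p)) (fst q))))
               l)) l) in
    snd s = 0 /\ 0 <= fst s.

Definition finprob {G : Type} (mu : G -> R) (S : list G) : Prop :=
  NoDup S /\ (forall g, 0 <= mu g) /\ (forall g, mu g <> 0 -> In g S) /\
  fold_right Rplus 0 (map mu S) = 1.

Definition symmetric_measure {G : Type} (inv : G -> G) (mu : G -> R) : Prop :=
  forall g, mu (inv g) = mu g.

Definition Expect {G : Type} (mu : G -> R) (S : list G) (f : G -> Cx) : Cx :=
  Csum (map (fun g => Cscale (mu g) (f g)) S).

Definition relative_T {G : Type} (mul : G -> G -> G) (inv : G -> G)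
  (mu : nat -> G -> R) (S : nat -> list G) : Prop :=
  forall phi : nat -> G -> Cx,
    (forall k, positive_definite mul inv (phi k)) ->
    (forall g, Un_cv (fun k => fst (phi k g)) 1 /\ Un_cv (fun k => snd (phi k g)) 0) ->
    forall eps, eps > 0 -> exists K : nat, forall k n, (k >= K)%nat ->
      Cmod (Cadd (Expect (mu n) (S n) (phi k)) (-1, 0)) < eps.

(* Main.v *)
Require Import Defs.
From Stdlib Require Import Reals List Factorial Lra Lia Classical ClassicalEpsilon
  FunctionalExtensionality.
Open Scope R_scope.

(** If [alpha] is a proper affine isometric action and [psi g = |alpha g 0|^2], the functions
    [exp (- psi / k)] are positive definite and tend to 1, while each of them vanishes at
    infinity; its mean with respect to [mu n] then tends to 0, so relative property T fails.

    Conversely, let [C] be the convex set of conditionally negative definite functions bounded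
    by [1 + L0]; it is compact for pointwise convergence. Suppose that for some [m] there is no
    [n] such that [C] contains a function above [m] on [L0 >= n]. By a minimax argument each
    [L0 >= n] carries a symmetric finitely supported probability under which every element of
    [C] has mean at most [m + 1]. If [phi k] are positive definite and tend to 1 pointwise, then
    [phi k e - Re (phi k)] lies in [eta C] for large [k], because it is bounded and [1 + L0] is
    proper; this gives relative property T. If there is no such [m], a series of elements of [C]
    is a proper conditionally negative definite function, and the GNS construction (carried out
    in the reproducing kernel Hilbert space of [psi g + psi h - psi (g^-1 h)]) yields a proper
    action. *)

(** * Finite formal combinations and positive semidefinite kernels *)

(** A list of pairs stands for a finite combination of point masses. Points may repeat, so addition
    is concatenation and no normal form has to be maintained. *)
Definition lin {X : Type} (f : X -> R) (y : list (R * X)) : R :=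
  fold_right (fun p s => fst p * f (snd p) + s) 0 y.

Definition scl {X : Type} (a : R) (y : list (R * X)) : list (R * X) :=
  map (fun p => (a * fst p, snd p)) y.

Definition bil {X : Type} (K : X -> X -> R) (x y : list (R * X)) : R :=
  lin (fun a => lin (K a) y) x.

Definition psd {X : Type} (K : X -> X -> R) : Prop :=
  (forall a b, K a b = K b a) /\ forall y, 0 <= bil K y y.

Lemma lin_app {X} (f : X -> R) x y : lin f (x ++ y) = lin f x + lin f y.
Proof. induction x as [|p x IH]; simpl; [|rewrite IH]; ring. Qed.

Lemma lin_scl {X} (f : X -> R) a y : lin f (scl a y) = a * lin f y.
Proof. induction y as [|p y IH]; simpl; [|rewrite IH]; ring. Qed.

Lemma lin_ext {X} (f g : X -> R) y : (forall a, f a = g a) -> lin f y = lin g y.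
Proof. intros E; induction y as [|p y IH]; simpl; [|rewrite IH, E]; ring. Qed.

Lemma lin_comb {X} a b (f g : X -> R) y :
  lin (fun x => a * f x + b * g x) y = a * lin f y + b * lin g y.
Proof. induction y as [|p y IH]; simpl; [|rewrite IH]; ring. Qed.

Lemma lin_add {X} (f g : X -> R) y : lin (fun x => f x + g x) y = lin f y + lin g y.
Proof. induction y as [|p y IH]; simpl; [|rewrite IH]; ring. Qed.

Lemma lin_mull {X} a (f : X -> R) y : lin (fun x => a * f x) y = a * lin f y.
Proof. induction y as [|p y IH]; simpl; [|rewrite IH]; ring. Qed.

Lemma lin_opp {X} (f : X -> R) y : lin (fun x => - f x) y = - lin f y.
Proof. induction y as [|p y IH]; simpl; [|rewrite IH]; ring. Qed.

Lemma lin_swap {X} (K : X -> X -> R) x y :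
  bil K x y = lin (fun b => lin (fun a => K a b) x) y.
Proof.
  unfold bil; induction x as [|p x IH]; simpl.
  - induction y as [|q y IHy]; simpl; [|rewrite <- IHy]; ring.
  - rewrite IH, <- lin_mull, <- lin_add. reflexivity.
Qed.

Lemma lin_cv {X} (f : nat -> X -> R) g y :
  (forall a, Un_cv (fun n => f n a) (g a)) -> Un_cv (fun n => lin (f n) y) (lin g y).
Proof.
  intros H; induction y as [|p y IH]; simpl.
  - intros e He; exists 0%nat; intros; unfold Rdist.
    rewrite Rminus_diag, Rabs_R0; exact He.
  - apply CV_plus; [apply CV_mult|exact IH]; [|apply H].
    intros e He; exists 0%nat; intros; unfold Rdist.
    rewrite Rminus_diag, Rabs_R0; exact He.
Qed.

Lemma bil_appl {X} (K : X -> X -> R) x x' y : bil K (x ++ x') y = bil K x y + bil K x' y.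
Proof. apply lin_app. Qed.

Lemma bil_scll {X} (K : X -> X -> R) a x y : bil K (scl a x) y = a * bil K x y.
Proof. apply lin_scl. Qed.

Lemma bil_cv {X} (K : nat -> X -> X -> R) L x y :
  (forall a b, Un_cv (fun n => K n a b) (L a b)) ->
  Un_cv (fun n => bil (K n) x y) (bil L x y).
Proof. intros H; apply lin_cv; intros a; apply lin_cv; intros b; apply H. Qed.

Lemma bil_ext {X} (K L : X -> X -> R) x y :
  (forall a b, K a b = L a b) -> bil K x y = bil L x y.
Proof. intros E; apply lin_ext; intros a; apply lin_ext; intros b; apply E. Qed.

Lemma bil_comb {X} a b (K L : X -> X -> R) x y :
  bil (fun u v => a * K u v + b * L u v) x y = a * bil K x y + b * bil L x y.
Proof.
  unfold bil; rewrite <- lin_comb; apply lin_ext; intros u; apply lin_comb.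
Qed.

Lemma bil_tensor {X} (f g : X -> R) x y :
  bil (fun u v => f u * g v) x y = lin f x * lin g y.
Proof.
  unfold bil; rewrite (lin_ext _ (fun a => lin g y * f a)).
  - rewrite lin_mull; ring.
  - intros a; rewrite lin_mull; ring.
Qed.

Lemma bil_sym {X} (K : X -> X -> R) x y : psd K -> bil K x y = bil K y x.
Proof.
  intros [S _]; rewrite lin_swap; apply lin_ext; intros b; apply lin_ext; intros a.
  apply S.
Qed.

Lemma bil_appr {X} (K : X -> X -> R) x y y' :
  psd K -> bil K x (y ++ y') = bil K x y + bil K x y'.
Proof. intros P; rewrite 3!(bil_sym K x) by exact P; apply bil_appl. Qed.

Lemma bil_sclr {X} (K : X -> X -> R) a x y :
  psd K -> bil K x (scl a y) = a * bil K x y.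
Proof. intros P; rewrite 2!(bil_sym K x) by exact P; apply bil_scll. Qed.

Lemma psd_comb {X} a b (K L : X -> X -> R) :
  0 <= a -> 0 <= b -> psd K -> psd L -> psd (fun u v => a * K u v + b * L u v).
Proof.
  intros Ha Hb [SK PK] [SL PL]; split.
  - intros u v; rewrite SK, SL; reflexivity.
  - intros y; rewrite bil_comb; specialize (PK y); specialize (PL y); nra.
Qed.

Lemma psd_ext {X} (K L : X -> X -> R) : (forall a b, K a b = L a b) -> psd K -> psd L.
Proof.
  intros E [S P]; split.
  - intros a b; rewrite <- !E; apply S.
  - intros y; rewrite <- (bil_ext K L) by exact E; apply P.
Qed.

Lemma Un_cv_le (u v : nat -> R) a b :
  Un_cv u a -> Un_cv v b -> (exists N, forall n, (n >= N)%nat -> u n <= v n) -> a <= b.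
Proof.
  intros Hu Hv [N HN]; destruct (Rle_lt_dec a b) as [|lt]; [assumption|exfalso].
  destruct (Hu ((a - b) / 2)) as [N1 H1]; [lra|].
  destruct (Hv ((a - b) / 2)) as [N2 H2]; [lra|].
  specialize (H1 (N + N1 + N2)%nat ltac:(lia)).
  specialize (H2 (N + N1 + N2)%nat ltac:(lia)).
  specialize (HN (N + N1 + N2)%nat ltac:(lia)).
  unfold Rdist in *; apply Rabs_def2 in H1; apply Rabs_def2 in H2; lra.
Qed.

Lemma Un_cv_const c : Un_cv (fun _ => c) c.
Proof.
  intros e He; exists 0%nat; intros; unfold Rdist; rewrite Rminus_diag, Rabs_R0; exact He.
Qed.

Lemma psd_cv {X} (K : nat -> X -> X -> R) L :
  (forall n, psd (K n)) -> (forall a b, Un_cv (fun n => K n a b) (L a b)) -> psd L.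
Proof.
  intros P C; split.
  - intros a b; apply (UL_sequence (fun n => K n a b)); [apply C|].
    intros e He; destruct (C b a e He) as [N HN]; exists N; intros n Hn.
    rewrite (proj1 (P n)); auto.
  - intros y; apply (Un_cv_le (fun _ => 0) (fun n => bil (K n) y y)).
    + apply Un_cv_const.
    + apply bil_cv, C.
    + exists 0%nat; intros; apply P.
Qed.

(** For positive [c] the quadratic is evaluated at its minimiser [- b / c]; for [c = 0] it is affine
    in [t], which forces [b = 0]. *)
Lemma discriminant_le a b c :
  0 <= c -> (forall t, 0 <= a + 2 * t * b + t * t * c) -> b * b <= a * c.
Proof.
  intros Hc H; destruct Hc as [Hc|Hc].
  - specialize (H (- b / c)).
    replace (a + 2 * (- b / c) * b + - b / c * (- b / c) * c)
      with ((a * c - b * b) / c) in H by (field; lra).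
    apply (Rmult_le_compat_r c) in H; [|lra].
    unfold Rdiv in H; rewrite Rmult_assoc, Rinv_l in H by lra; lra.
  - subst c; destruct (Req_dec b 0) as [->|Hb]; [lra|].
    (* This [t] gives the affine function the value [-1]. *)
    specialize (H (- (a + 1) / (2 * b))).
    replace (a + 2 * (- (a + 1) / (2 * b)) * b + - (a + 1) / (2 * b) * (- (a + 1) / (2 * b)) * 0)
      with (-1) in H by (field; lra).
    lra.
Qed.

Lemma bil_cauchy_schwarz {X} (K : X -> X -> R) x y :
  psd K -> bil K x y * bil K x y <= bil K x x * bil K y y.
Proof.
  intros P; apply discriminant_le; [apply P|]; intros t.
  pose proof (proj2 P (x ++ scl t y)) as H.
  rewrite bil_appl, !(bil_appr K) in H by exact P.
  rewrite !bil_scll, !bil_sclr, (bil_sym K y x) in H by exact P; nra.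
Qed.

(** * The Hilbert space of a positive semidefinite kernel *)

Lemma Rabs_le_bounds a b : Rabs a <= b -> - b <= a <= b.
Proof.
  intros H; pose proof (Rle_abs a); pose proof (Rle_abs (- a)); rewrite Rabs_Ropp in *; lra.
Qed.

Lemma le_of_le_eps a b M : (forall e, 0 < e <= 1 -> a <= b + M * e) -> a <= b.
Proof.
  intros H; destruct (Rle_lt_dec a b) as [|lt]; [assumption|exfalso].
  set (d := 2 * (Rabs M + 1) + (a - b)).
  assert (HM := Rabs_pos M); assert (Hd : d > 0) by (unfold d; lra).
  assert (He : 0 < (a - b) / d <= 1).
  { split; [apply Rdiv_lt_0_compat; lra|].
    apply (Rmult_le_reg_r d); [lra|]; unfold Rdiv; rewrite Rmult_assoc, Rinv_l; unfold d; lra. }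
  specialize (H _ He).
  assert (M * ((a - b) / d) <= Rabs M * ((a - b) / d))
    by (apply Rmult_le_compat_r; [lra|apply Rle_abs]).
  assert (E : (a - b) / d * d = a - b) by (field; lra).
  unfold d in E at 2; nra.
Qed.

Section RKHS.
Context {X : Type} (K : X -> X -> R) (PK : psd K).

Definition nrm (y : list (R * X)) : R := sqrt (bil K y y).

Lemma nrm_pos y : 0 <= nrm y.
Proof. apply sqrt_pos. Qed.

Lemma nrm_sqr y : nrm y * nrm y = bil K y y.
Proof. apply sqrt_sqrt, PK. Qed.

Lemma bil_le_nrm x y : Rabs (bil K x y) <= nrm x * nrm y.
Proof.
  unfold nrm; rewrite <- sqrt_mult by apply PK; rewrite <- sqrt_Rsqr_abs.
  apply sqrt_le_1; [apply Rle_0_sqr| |apply bil_cauchy_schwarz, PK].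
  apply Rmult_le_pos; apply PK.
Qed.

(* [x] approximates [f] up to [e] in the norm dual to [nrm]; the Hilbert space consists of
   the functions which are approximable for every [e]. *)
Definition approx (f : X -> R) (x : list (R * X)) (e : R) : Prop :=
  forall y, Rabs (lin f y - bil K x y) <= e * nrm y.

Definition approximable (f : X -> R) : Prop := forall e, e > 0 -> exists x, approx f x e.

Definition dual_bound (f : X -> R) (C : R) : Prop := forall y, Rabs (lin f y) <= C * nrm y.

Lemma approx_le f x e e' : e <= e' -> approx f x e -> approx f x e'.
Proof.
  intros H A y; eapply Rle_trans; [apply A|].
  apply Rmult_le_compat_r; [apply nrm_pos|exact H].
Qed.

Lemma approx_add f g x y e e' :
  approx f x e -> approx g y e' -> approx (fun a => f a + g a) (x ++ y) (e + e').
Proof.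
  intros A B z; rewrite lin_add, bil_appl; specialize (A z); specialize (B z).
  replace (lin f z + lin g z - (bil K x z + bil K y z))
    with ((lin f z - bil K x z) + (lin g z - bil K y z)) by ring.
  eapply Rle_trans; [apply Rabs_triang|lra].
Qed.

Lemma approx_scal f x a e :
  approx f x e -> approx (fun u => a * f u) (scl a x) (Rabs a * e).
Proof.
  intros A z; rewrite lin_mull, bil_scll, <- Rmult_minus_distr_l, Rabs_mult, Rmult_assoc.
  apply Rmult_le_compat_l; [apply Rabs_pos|apply A].
Qed.

Lemma approx_zero : approx (fun _ => 0) nil 0.
Proof.
  intros y; replace (lin (fun _ : X => 0) y) with 0.
  - unfold bil; simpl; rewrite Rminus_diag, Rabs_R0; lra.
  - induction y as [|p y IH]; simpl; [|rewrite <- IH]; ring.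
Qed.

Lemma approximable_of_zero f x : approx f x 0 -> approximable f.
Proof. intros A e He; exists x; apply (approx_le f x 0 e); [lra|exact A]. Qed.

Lemma approximable_add f g :
  approximable f -> approximable g -> approximable (fun a => f a + g a).
Proof.
  intros A B e He; destruct (A (e / 2)) as [x Hx]; [lra|].
  destruct (B (e / 2)) as [y Hy]; [lra|]; exists (x ++ y).
  replace e with (e / 2 + e / 2) by field; apply approx_add; assumption.
Qed.

Lemma small_scaling a e : e > 0 -> e / (Rabs a + 1) > 0 /\ Rabs a * (e / (Rabs a + 1)) <= e.
Proof.
  intros He; assert (Ha := Rabs_pos a); assert (Hd : e / (Rabs a + 1) > 0).
  { apply Rdiv_lt_0_compat; lra. }
  split; [exact Hd|].
  assert ((Rabs a + 1) * (e / (Rabs a + 1)) = e) by (field; lra); lra.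
Qed.

Lemma approximable_scal f a : approximable f -> approximable (fun u => a * f u).
Proof.
  intros A e He; destruct (small_scaling a e He) as [H1 H2].
  destruct (A _ H1) as [x Hx]; exists (scl a x).
  eapply approx_le; [exact H2|]; apply approx_scal, Hx.
Qed.

Lemma approximable_opp f : approximable f -> approximable (fun u => - f u).
Proof.
  intros A; replace (fun u => - f u) with (fun u => -1 * f u); [apply approximable_scal, A|].
  extensionality u; ring.
Qed.

Lemma approx_dual_bound f x e : approx f x e -> dual_bound f (nrm x + e).
Proof.
  intros A y; specialize (A y); pose proof (bil_le_nrm x y).
  replace (lin f y) with (bil K x y + (lin f y - bil K x y)) by ring.
  eapply Rle_trans; [apply Rabs_triang|lra].
Qed.

(** Testing against [x] itself gives [nrm x * nrm x <= (C + e) * nrm x], and [nrm x] cancels unless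
    it is 0. *)
Lemma dual_bound_nrm f C x e : 0 <= C + e -> dual_bound f C -> approx f x e -> nrm x <= C + e.
Proof.
  intros Ce B A; specialize (A x); specialize (B x).
  assert (H : bil K x x <= (C + e) * nrm x).
  { replace (bil K x x) with (lin f x + (bil K x x - lin f x)) by ring.
    pose proof (Rle_abs (lin f x)); pose proof (Rle_abs (- (lin f x - bil K x x))).
    rewrite Rabs_Ropp in *; lra. }
  rewrite <- nrm_sqr in H; destruct (nrm_pos x) as [Hp|Hp]; [|rewrite <- Hp; exact Ce].
  apply Rmult_le_reg_r in H; assumption.
Qed.

Lemma approx_pair f x y e e' z :
  approx f x e -> approx f y e' -> Rabs (bil K x z - bil K y z) <= (e + e') * nrm z.
Proof.
  intros A B; specialize (A z); specialize (B z).
  replace (bil K x z - bil K y z)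
    with (- (lin f z - bil K x z) + (lin f z - bil K y z)) by ring.
  eapply Rle_trans; [apply Rabs_triang|]; rewrite Rabs_Ropp; lra.
Qed.

(** The inner product is the limit of [bil K x y] over approximations of [f] and [g]. A relation
    with an error linear in [e] makes it independent of any chosen approximating sequences. *)
Definition is_inner (f g : X -> R) (r : R) : Prop :=
  exists M, forall e x y, 0 < e <= 1 -> approx f x e -> approx g y e ->
    Rabs (bil K x y - r) <= M * e.

Lemma approximable_dual_bound f : approximable f -> exists C, 0 <= C /\ dual_bound f C.
Proof.
  intros A; destruct (A 1) as [x Hx]; [lra|]; exists (nrm x + 1); split.
  - pose proof (nrm_pos x); lra.
  - apply approx_dual_bound, Hx.
Qed.

(** One argument is changed at a time, while the norm of the other stays bounded through a dual
    bound of [f] or [g]. *)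
Lemma bil_approx_cauchy f g : approximable f -> approximable g -> exists M, 0 <= M /\
  forall e e' x y x' y', 0 < e <= 1 -> 0 < e' <= 1 ->
    approx f x e -> approx g y e -> approx f x' e' -> approx g y' e' ->
    Rabs (bil K x y - bil K x' y') <= M * (e + e').
Proof.
  intros Af Ag; destruct (approximable_dual_bound f Af) as [C [C0 HC]].
  destruct (approximable_dual_bound g Ag) as [D [D0 HD]].
  exists (C + D + 2); split; [lra|]; intros e e' x y x' y' He He' A1 A2 A3 A4.
  pose proof (approx_pair f x x' e e' y A1 A3) as E1.
  pose proof (approx_pair g y y' e e' x' A2 A4) as E2.
  rewrite !(bil_sym K _ x') in E2 by exact PK.
  pose proof (dual_bound_nrm f C x' e' ltac:(lra) HC A3).
  pose proof (dual_bound_nrm g D y e ltac:(lra) HD A2).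
  replace (bil K x y - bil K x' y')
    with ((bil K x y - bil K x' y) + (bil K x' y - bil K x' y')) by ring.
  eapply Rle_trans; [apply Rabs_triang|].
  assert ((e + e') * nrm y <= (e + e') * (D + 1)) by (apply Rmult_le_compat_l; lra).
  assert ((e + e') * nrm x' <= (e + e') * (C + 1)) by (apply Rmult_le_compat_l; lra).
  lra.
Qed.

Lemma inv_INR_S n : 0 < / INR (S n) <= 1.
Proof.
  assert (1 <= INR (S n)) by (rewrite S_INR; pose proof (pos_INR n); lra).
  split; [apply Rinv_0_lt_compat; lra|].
  rewrite <- Rinv_1; apply Rinv_le_contravar; lra.
Qed.

Lemma inv_INR_small e : e > 0 -> exists N, forall n, (n >= N)%nat -> / INR (S n) < e.
Proof.
  intros He; destruct (archimed_cor1 e He) as [N [H1 H2]]; exists N; intros n Hn.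
  eapply Rle_lt_trans; [|exact H1]; apply Rinv_le_contravar.
  - apply lt_0_INR; lia.
  - apply le_INR; lia.
Qed.

(** The value is the limit along approximations of error [/ INR (S n)]; comparing any other pair
    with this sequence gives the rate. *)
Lemma is_inner_exists f g : approximable f -> approximable g -> exists r, is_inner f g r.
Proof.
  intros Af Ag; destruct (bil_approx_cauchy f g Af Ag) as [M [M0 HM]].
  assert (P : forall h, approximable h ->
            exists u : nat -> list (R * X), forall n, approx h (u n) (/ INR (S n))).
  { intros h Ah; exists (fun n => proj1_sig (constructive_indefinite_description _
      (Ah _ (proj1 (inv_INR_S n))))).
    intros n; destruct constructive_indefinite_description; assumption. }
  destruct (P f Af) as [u Hu]; destruct (P g Ag) as [v Hv].
  assert (CS : Cauchy_crit (fun n => bil K (u n) (v n))).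
  { intros e He; destruct (inv_INR_small (e / (2 * (M + 1)))) as [N HN].
    { apply Rdiv_lt_0_compat; lra. }
    exists N; intros n m Hn Hm; unfold Rdist.
    eapply Rle_lt_trans; [apply (HM (/ INR (S n)) (/ INR (S m)));
      auto using inv_INR_S|].
    pose proof (HN n Hn); pose proof (HN m Hm).
    pose proof (inv_INR_S n); pose proof (inv_INR_S m).
    apply Rle_lt_trans with ((M + 1) * (/ INR (S n) + / INR (S m))).
    - apply Rmult_le_compat_r; lra.
    - assert (E : (M + 1) * (e / (2 * (M + 1)) + e / (2 * (M + 1))) = e) by (field; lra).
      rewrite <- E; apply Rmult_lt_compat_l; lra. }
  destruct (R_complete _ CS) as [r Hr]; exists r; exists M.
  intros e x y He Ax Ay; apply (le_of_le_eps _ _ (M + 1)); intros d Hd.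
  destruct (Hr d) as [N1 H1]; [lra|]; destruct (inv_INR_small d) as [N2 H2]; [lra|].
  set (n := (N1 + N2)%nat); specialize (H1 n ltac:(lia)); specialize (H2 n ltac:(lia)).
  unfold Rdist in H1.
  pose proof (HM e (/ INR (S n)) x y (u n) (v n) He (inv_INR_S n) Ax Ay (Hu n) (Hv n)).
  replace (bil K x y - r)
    with ((bil K x y - bil K (u n) (v n)) + (bil K (u n) (v n) - r)) by ring.
  eapply Rle_trans; [apply Rabs_triang|].
  assert (M * / INR (S n) <= M * d) by (apply Rmult_le_compat_l; lra); lra.
Qed.

(* Approximations of a sum need not be sums of approximations, so inner products are
   identified along one well-chosen family. *)
Lemma is_inner_eq f g r s M : is_inner f g r ->
  (forall e, 0 < e <= 1 -> exists x y, approx f x e /\ approx g y e /\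
     Rabs (bil K x y - s) <= M * e) -> r = s.
Proof.
  intros [N HN] H; cut (Rabs (r - s) <= 0).
  { intros L; pose proof (Rle_abs (r - s)); pose proof (Rle_abs (- (r - s))).
    rewrite Rabs_Ropp in *; lra. }
  apply (le_of_le_eps _ _ (N + M)); intros e He.
  destruct (H e He) as [x [y [A [B L]]]]; specialize (HN e x y He A B).
  replace (r - s) with (- (bil K x y - r) + (bil K x y - s)) by ring.
  eapply Rle_trans; [apply Rabs_triang|]; rewrite Rabs_Ropp; lra.
Qed.

Lemma is_inner_add f g h r s t : approximable f -> approximable g -> approximable h ->
  is_inner f h r -> is_inner g h s -> is_inner (fun a => f a + g a) h t -> t = r + s.
Proof.
  intros Af Ag Ah [M HM] [N HN] I; apply (is_inner_eq _ _ _ _ (M + N) I); intros e He.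
  destruct (Af (e / 2)) as [x Hx]; [lra|]; destruct (Ag (e / 2)) as [y Hy]; [lra|].
  destruct (Ah e) as [z Hz]; [lra|]; exists (x ++ y), z; split; [|split; [exact Hz|]].
  - replace e with (e / 2 + e / 2) by field; apply approx_add; assumption.
  - rewrite bil_appl.
    replace (bil K x z + bil K y z - (r + s)) with ((bil K x z - r) + (bil K y z - s)) by ring.
    eapply Rle_trans; [apply Rabs_triang|]; rewrite Rmult_plus_distr_r.
    apply Rplus_le_compat; [apply HM|apply HN]; auto.
    + eapply approx_le; [|exact Hx]; lra.
    + eapply approx_le; [|exact Hy]; lra.
Qed.

Lemma is_inner_scal f g a r t : approximable f -> approximable g ->
  is_inner f g r -> is_inner (fun u => a * f u) g t -> t = a * r.
Proof.
  intros Af Ag [M HM] I; apply (is_inner_eq _ _ _ _ (Rabs a * M) I); intros e He.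
  destruct (small_scaling a e ltac:(lra)) as [H1 H2].
  destruct (Af (Rmin e (e / (Rabs a + 1)))) as [x Hx]; [apply Rmin_glb_lt; lra|].
  destruct (Ag e) as [y Hy]; [lra|]; exists (scl a x), y; split; [|split; [exact Hy|]].
  - eapply approx_le; [|apply approx_scal, Hx].
    eapply Rle_trans; [|exact H2]; apply Rmult_le_compat_l; [apply Rabs_pos|apply Rmin_r].
  - rewrite bil_scll, <- Rmult_minus_distr_l, Rabs_mult, Rmult_assoc.
    apply Rmult_le_compat_l; [apply Rabs_pos|]; apply HM; auto.
    eapply approx_le; [|exact Hx]; apply Rmin_l.
Qed.

Lemma is_inner_pos f r : approximable f -> is_inner f f r -> 0 <= r.
Proof.
  intros A [M HM]; apply (le_of_le_eps _ _ M); intros e He.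
  destruct (A e) as [x Hx]; [lra|]; specialize (HM e x x He Hx Hx).
  pose proof (proj2 PK x); apply Rabs_le_bounds in HM; lra.
Qed.

(** Together with [is_inner_le_dual_bound] this makes [sqrt r] the least dual bound of [f].
    Distances can then be estimated by testing against combinations, as in [rk_dist_le]. *)
Lemma is_inner_dual_bound f r : approximable f -> is_inner f f r -> dual_bound f (sqrt r).
Proof.
  intros A I; pose proof (is_inner_pos f r A I) as Hr; destruct I as [M HM]; intros y.
  destruct (approximable_dual_bound f A) as [C [C0 HC]].
  apply Rsqr_incr_0_var; [|apply Rmult_le_pos; [apply sqrt_pos|apply nrm_pos]].
  rewrite <- Rsqr_abs; unfold Rsqr.
  replace (sqrt r * nrm y * (sqrt r * nrm y)) with (r * bil K y y)
    by (rewrite <- nrm_sqr; rewrite <- (sqrt_sqrt r) at 1 by exact Hr; ring).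
  apply (le_of_le_eps _ _ ((M + 2 * (C + 1) + 1) * bil K y y)); intros e He.
  destruct (A e) as [x Hx]; [lra|]; specialize (HM e x x He Hx Hx).
  pose proof (approx_dual_bound f x e Hx y) as Hy.
  pose proof (dual_bound_nrm f C x e ltac:(lra) HC Hx) as Hn.
  assert (S : lin f y * lin f y <= (nrm x + e) * nrm y * ((nrm x + e) * nrm y)).
  { change (Rsqr (lin f y) <= Rsqr ((nrm x + e) * nrm y)).
    apply Rsqr_le_abs_1; rewrite (Rabs_right ((nrm x + e) * nrm y)); [exact Hy|].
    apply Rle_ge, Rmult_le_pos; pose proof (nrm_pos x); pose proof (nrm_pos y); lra. }
  eapply Rle_trans; [exact S|].
  replace ((nrm x + e) * nrm y * ((nrm x + e) * nrm y))
    with ((bil K x x + 2 * e * nrm x + e * e) * bil K y y) by (rewrite <- !nrm_sqr; ring).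
  replace (r * bil K y y + (M + 2 * (C + 1) + 1) * bil K y y * e)
    with ((r + M * e + 2 * e * (C + 1) + 1 * e) * bil K y y) by ring.
  apply Rmult_le_compat_r; [apply PK|]; apply Rabs_le_bounds in HM.
  assert (e * nrm x <= e * (C + 1)) by (apply Rmult_le_compat_l; lra).
  assert (e * e <= 1 * e) by (apply Rmult_le_compat_r; lra); lra.
Qed.

Lemma is_inner_le_dual_bound f r C :
  approximable f -> is_inner f f r -> 0 <= C -> dual_bound f C -> sqrt r <= C.
Proof.
  intros A I C0 HC; rewrite <- (sqrt_Rsqr C) by exact C0.
  pose proof (is_inner_pos f r A I) as Hr; destruct I as [M HM].
  apply sqrt_le_1; [exact Hr|apply Rle_0_sqr|]; unfold Rsqr.
  apply (le_of_le_eps _ _ (M + 2 * C + 1)); intros e He.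
  destruct (A e) as [x Hx]; [lra|]; specialize (HM e x x He Hx Hx).
  pose proof (dual_bound_nrm f C x e ltac:(lra) HC Hx) as Hn.
  apply Rabs_le_bounds in HM; rewrite <- nrm_sqr in HM; pose proof (nrm_pos x).
  assert (nrm x * nrm x <= (C + e) * (C + e)) by (apply Rmult_le_compat; lra).
  assert (e * e <= 1 * e) by (apply Rmult_le_compat_r; lra); lra.
Qed.

(** Elements are functions on [X] instead of classes of combinations or of Cauchy sequences, so
    equality is pointwise and no quotient is taken. *)
Definition rk : Type := {f : X -> R | approximable f}.

Lemma rk_eq (f g : rk) : (forall a, proj1_sig f a = proj1_sig g a) -> f = g.
Proof.
  intros E; apply eq_sig_hprop; [intros; apply proof_irrelevance|].
  extensionality a; apply E.
Qed.

Definition rk_zero : rk := exist _ _ (approximable_of_zero _ _ approx_zero).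
Definition rk_add (f g : rk) : rk :=
  exist _ _ (approximable_add _ _ (proj2_sig f) (proj2_sig g)).
Definition rk_opp (f : rk) : rk := exist _ _ (approximable_opp _ (proj2_sig f)).
Definition rk_scal (a : R) (f : rk) : rk := exist _ _ (approximable_scal _ a (proj2_sig f)).

Definition rk_inner (f g : rk) : R :=
  proj1_sig (constructive_indefinite_description _
    (is_inner_exists _ _ (proj2_sig f) (proj2_sig g))).

Lemma rk_innerP f g : is_inner (proj1_sig f) (proj1_sig g) (rk_inner f g).
Proof. unfold rk_inner; destruct constructive_indefinite_description; assumption. Qed.

Definition rk_dist (f g : rk) : R :=
  sqrt (rk_inner (rk_add f (rk_opp g)) (rk_add f (rk_opp g))).

Lemma rk_dist_le (f g : rk) C : 0 <= C ->
  rk_dist f g <= C <->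
  forall y, Rabs (lin (proj1_sig f) y - lin (proj1_sig g) y) <= C * nrm y.
Proof.
  intros C0; set (h := rk_add f (rk_opp g)).
  assert (E : forall y, lin (proj1_sig h) y = lin (proj1_sig f) y - lin (proj1_sig g) y).
  { intros y; simpl; rewrite lin_add, lin_opp; ring. }
  split.
  - intros H y; rewrite <- E; eapply Rle_trans.
    + apply (is_inner_dual_bound _ _ (proj2_sig h) (rk_innerP h h)).
    + apply Rmult_le_compat_r; [apply nrm_pos|exact H].
  - intros H; apply (is_inner_le_dual_bound _ _ _ (proj2_sig h) (rk_innerP h h) C0).
    intros y; rewrite E; apply H.
Qed.

Lemma rk_dist_bound (f g : rk) y :
  Rabs (lin (proj1_sig f) y - lin (proj1_sig g) y) <= rk_dist f g * nrm y.
Proof. apply (proj1 (rk_dist_le f g _ (sqrt_pos _)) (Rle_refl _)). Qed.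

Lemma lin_single (f : X -> R) a : lin f ((1, a) :: nil) = f a.
Proof. simpl; ring. Qed.

(** Testing on point masses gives a pointwise limit. The Cauchy estimate passes to this limit, and
    an approximation of a late [u N] also approximates it. *)
Lemma rk_complete (u : nat -> rk) :
  (forall eps, eps > 0 -> exists N, forall m n, (m >= N)%nat -> (n >= N)%nat ->
     rk_dist (u m) (u n) < eps) ->
  exists l, forall eps, eps > 0 -> exists N, forall n, (n >= N)%nat -> rk_dist (u n) l < eps.
Proof.
  intros HC.
  assert (HC' : forall eps, eps > 0 -> exists N, forall m n, (m >= N)%nat -> (n >= N)%nat ->
     forall y, Rabs (lin (proj1_sig (u m)) y - lin (proj1_sig (u n)) y) <= eps * nrm y).
  { intros e He; destruct (HC e He) as [N HN]; exists N; intros m n Hm Hn.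
    apply rk_dist_le; [lra|]; left; apply HN; assumption. }
  assert (Lim : forall a, exists l, Un_cv (fun n => proj1_sig (u n) a) l).
  { intros a; cut (Cauchy_crit (fun n => proj1_sig (u n) a)).
    { intros C; destruct (R_complete _ C) as [l Hl]; exists l; exact Hl. }
    intros e He; set (c := nrm ((1, a) :: nil)); pose proof (nrm_pos ((1, a) :: nil)).
    destruct (HC' (e / (c + 1))) as [N HN]; [apply Rdiv_lt_0_compat; unfold c; lra|].
    exists N; intros m n Hm Hn; specialize (HN m n Hm Hn ((1, a) :: nil)).
    rewrite !lin_single in HN; eapply Rle_lt_trans; [exact HN|]; fold c in H |- *.
    assert (e / (c + 1) * (c + 1) = e) by (field; lra).
    assert (e / (c + 1) > 0) by (apply Rdiv_lt_0_compat; lra); nra. }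
  set (f := fun a => proj1_sig (constructive_indefinite_description _ (Lim a))).
  assert (Hf : forall y, Un_cv (fun n => lin (proj1_sig (u n)) y) (lin f y)).
  { intros y; apply lin_cv; intros a; unfold f.
    destruct constructive_indefinite_description; assumption. }
  assert (HL : forall eps, eps > 0 -> exists N, forall n, (n >= N)%nat ->
     forall y, Rabs (lin (proj1_sig (u n)) y - lin f y) <= eps * nrm y).
  { intros e He; destruct (HC' e He) as [N HN]; exists N; intros n Hn y.
    apply (Un_cv_le (fun m => Rabs (lin (proj1_sig (u n)) y - lin (proj1_sig (u m)) y))
      (fun _ => e * nrm y)); [|apply Un_cv_const|exists N; auto].
    apply cv_cvabs, CV_minus; [apply Un_cv_const|apply Hf]. }
  assert (Af : approximable f).
  { intros e He; destruct (HL (e / 2)) as [N HN]; [lra|].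
    destruct (proj2_sig (u N) (e / 2)) as [x Hx]; [lra|]; exists x; intros y.
    specialize (HN N ltac:(lia) y); specialize (Hx y).
    replace (lin f y - bil K x y) with
      (- (lin (proj1_sig (u N)) y - lin f y) + (lin (proj1_sig (u N)) y - bil K x y)) by ring.
    eapply Rle_trans; [apply Rabs_triang|]; rewrite Rabs_Ropp; lra. }
  exists (exist _ f Af); intros e He; destruct (HL (e / 2)) as [N HN]; [lra|].
  exists N; intros n Hn; apply Rle_lt_trans with (e / 2); [|lra].
  apply rk_dist_le; [lra|]; apply HN, Hn.
Qed.

(** Kept transparent: later proofs identify [hdist] with [rk_dist] by conversion. *)
Definition rkhs : HilbertSpace.
Proof.
  refine {| hV := rk; h0 := rk_zero; hadd := rk_add; hopp := rk_opp; hscal := rk_scal;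
            hinner := rk_inner; h_complete := rk_complete |};
    try (intros; apply rk_eq; intros; simpl; ring).
  - intros x y; apply (is_inner_eq _ _ _ _ (proj1_sig (constructive_indefinite_description _
      (rk_innerP y x))) (rk_innerP x y)); intros e He.
    destruct constructive_indefinite_description as [M HM]; simpl.
    destruct (proj2_sig x e) as [a Ha]; [lra|]; destruct (proj2_sig y e) as [b Hb]; [lra|].
    exists a, b; repeat split; auto; rewrite bil_sym by exact PK; auto.
  - intros x y z; apply (is_inner_add (proj1_sig x) (proj1_sig y) (proj1_sig z));
      first [apply proj2_sig|apply rk_innerP|apply (rk_innerP (rk_add x y) z)].
  - intros a x y; apply (is_inner_scal (proj1_sig x) (proj1_sig y) a);
      first [apply proj2_sig|apply rk_innerP|apply (rk_innerP (rk_scal a x) y)].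
  - intros x; apply (is_inner_pos _ _ (proj2_sig x) (rk_innerP x x)).
  - intros x Hx; apply rk_eq; intros a; simpl.
    pose proof (is_inner_dual_bound _ _ (proj2_sig x) (rk_innerP x x) ((1, a) :: nil)) as H.
    rewrite Hx, sqrt_0, Rmult_0_l, lin_single in H; apply Rabs_le_bounds in H; lra.
Defined.

End RKHS.

(** * Schur products and Schoenberg's theorem *)

Lemma psd_tensor {X} (f : X -> R) : psd (fun a b => f a * f b).
Proof.
  split; [intros; ring|]; intros y; rewrite bil_tensor; apply Rle_0_sqr.
Qed.

Lemma psd_vanish {X} (K : X -> X -> R) a b : psd K -> K a a = 0 -> K a b = 0.
Proof.
  intros P H; pose proof (bil_cauchy_schwarz K ((1, a) :: nil) ((1, b) :: nil) P) as C.
  unfold bil in C; simpl in C; rewrite H in C; nra.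
Qed.

(* One step of Gaussian elimination; when [K x x = 0] the quotient is [0]. *)
Definition eliminate {X} (K : X -> X -> R) (x a b : X) : R := K a b - / K x x * (K a x * K b x).

(** Nonnegativity is the Cauchy-Schwarz inequality between [y] and the point mass at [x], divided by
    [K x x]. *)
Lemma psd_eliminate {X} (K : X -> X -> R) x : psd K -> psd (eliminate K x).
Proof.
  intros P; split.
  - intros a b; unfold eliminate; rewrite (proj1 P a b); ring.
  - intros y; pose proof (bil_cauchy_schwarz K y ((1, x) :: nil) P) as C.
    unfold eliminate.
    rewrite (bil_ext _ (fun a b => 1 * K a b + (- / K x x) * (K a x * K b x)))
      by (intros; ring).
    rewrite bil_comb, (bil_tensor (fun a => K a x) (fun a => K a x)).
    replace (bil K y ((1, x) :: nil)) with (lin (fun a => K a x) y) in C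
      by (apply lin_ext; intros; simpl; ring).
    replace (bil K ((1, x) :: nil) ((1, x) :: nil)) with (K x x) in C
      by (unfold bil; simpl; ring).
    pose proof (proj2 P ((1, x) :: nil)) as Hx; unfold bil in Hx; simpl in Hx.
    pose proof (proj2 P y).
    (* At a zero pivot [/ 0 = 0], so elimination leaves [K] unchanged. *)
    destruct (Req_dec (K x x) 0) as [E|E]; [rewrite E, Rinv_0; lra|].
    assert (0 < K x x) by lra.
    apply (Rmult_le_reg_r (K x x)); [assumption|].
    replace ((1 * bil K y y +
        - / K x x * (lin (fun a => K a x) y * lin (fun a => K a x) y)) * K x x)
      with (bil K y y * K x x - lin (fun a => K a x) y * lin (fun a => K a x) y)
      by (field; exact E).
    lra.
Qed.

Lemma eliminate_pivot {X} (K : X -> X -> R) x b : psd K -> eliminate K x x b = 0.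
Proof.
  intros P; unfold eliminate; rewrite (proj1 P b x).
  destruct (Req_dec (K x x) 0) as [E|E]; [|field; exact E].
  rewrite (psd_vanish K x b P E); ring.
Qed.

Lemma bil_zero {X} (K : X -> X -> R) x y :
  (forall p, In p x -> forall b, K (snd p) b = 0) -> bil K x y = 0.
Proof.
  intros H; unfold bil; induction x as [|p x IH]; simpl; [reflexivity|].
  rewrite IH by (intros; apply H; right; assumption).
  rewrite (lin_ext _ (fun _ => 0 * 0)) by (intros; rewrite H by (left; reflexivity); ring).
  rewrite lin_mull; ring.
Qed.

Lemma bil_weighted {X} (f : X -> R) (L : X -> X -> R) y :
  bil (fun a b => f a * f b * L a b) y y =
  bil L (map (fun p => (fst p * f (snd p), snd p)) y)
        (map (fun p => (fst p * f (snd p), snd p)) y).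
Proof.
  assert (E : forall g z, lin g (map (fun p => (fst p * f (snd p), snd p)) z)
                        = lin (fun a => f a * g a) z).
  { intros g z; induction z as [|p z IH]; simpl; [|rewrite IH]; ring. }
  unfold bil; rewrite E; apply lin_ext; intros a; rewrite E, <- lin_mull.
  apply lin_ext; intros b; ring.
Qed.

(** Schur's product theorem. [K] is its elimination at [x] plus a rank-one kernel, and the rank-one
    part times [L] is [L] evaluated on coefficients reweighted by [K a x]. *)
Lemma psd_mul {X} (K L : X -> X -> R) : psd K -> psd L -> psd (fun a b => K a b * L a b).
Proof.
  intros PK PL; split; [intros a b; rewrite (proj1 PK a b), (proj1 PL a b); reflexivity|].
  (* The induction runs over the points still to be eliminated; at every other point of [y] the row
     of [K] vanishes. *)
  intros y; cut (forall pts K, psd K ->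
    (forall p, In p y -> In (snd p) pts \/ forall b, K (snd p) b = 0) ->
    0 <= bil (fun a b => K a b * L a b) y y).
  { intros H; apply (H (map snd y)); [exact PK|]; intros p Hp; left; apply in_map, Hp. }
  clear K PK; induction pts as [|x pts IH]; intros K PK Hy.
  - rewrite bil_zero; [lra|]; intros p Hp b.
    destruct (Hy p Hp) as [[]|H]; rewrite H; ring.
  - rewrite (bil_ext _ (fun a b => 1 * (eliminate K x a b * L a b)
      + / K x x * (K a x * K b x * L a b))) by (intros; unfold eliminate; ring).
    rewrite (bil_comb 1 _ _ (fun a b => K a x * K b x * L a b)).
    rewrite (bil_weighted (fun a => K a x)).
    assert (0 <= bil (fun a b => eliminate K x a b * L a b) y y).
    { apply IH; [apply psd_eliminate, PK|]; intros p Hp.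
      destruct (Hy p Hp) as [[<-|H]|H].
      - right; intros b; apply eliminate_pivot, PK.
      - left; exact H.
      - right; intros b; unfold eliminate; rewrite !H; ring. }
    assert (0 <= / K x x).
    { pose proof (proj2 PK ((1, x) :: nil)) as Hx; unfold bil in Hx; simpl in Hx.
      destruct (Req_dec (K x x) 0) as [E|E]; [rewrite E, Rinv_0; lra|].
      left; apply Rinv_0_lt_compat; lra. }
    rewrite Rmult_1_l; apply Rplus_le_le_0_compat; [assumption|].
    apply Rmult_le_pos; [assumption|apply PL].
Qed.

Lemma psd_scal {X} c (K : X -> X -> R) : 0 <= c -> psd K -> psd (fun a b => c * K a b).
Proof.
  intros Hc P; apply (psd_ext (fun a b => c * K a b + 0 * K a b)); [intros; ring|].
  apply psd_comb; auto; lra.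
Qed.

Lemma psd_pow {X} (K : X -> X -> R) n : psd K -> psd (fun a b => K a b ^ n).
Proof.
  intros P; induction n as [|n IH]; simpl.
  - apply (psd_ext (fun _ _ => 1 * 1)); [intros; ring|apply (psd_tensor (fun _ => 1))].
  - apply psd_mul; assumption.
Qed.

(** The partial sums of the exponential series are nonnegative combinations of Schur powers, and
    positivity survives pointwise limits. *)
Lemma psd_exp {X} (K : X -> X -> R) : psd K -> psd (fun a b => exp (K a b)).
Proof.
  intros P.
  apply (psd_cv (fun n a b => sum_f_R0 (fun i => / INR (fact i) * K a b ^ i) n)).
  - intros n; induction n as [|n IH].
    + apply (psd_ext (fun a b => / INR (fact 0) * K a b ^ 0)); [reflexivity|].
      apply psd_scal; [simpl; lra|apply psd_pow, P].
    + apply (psd_ext (fun a b => 1 * sum_f_R0 (fun i => / INR (fact i) * K a b ^ i) n +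
               / INR (fact (S n)) * K a b ^ S n)); [intros; rewrite tech5; ring|].
      apply psd_comb; [lra| |exact IH|apply psd_pow, P].
      left; apply Rinv_0_lt_compat, INR_fact_lt_0.
  - intros a b; unfold exp; destruct (exist_exp (K a b)) as [l Hl]; exact Hl.
Qed.

(** * Gram and Gaussian kernels of vectors in a Hilbert space *)

Lemma h_inner0 (H : HilbertSpace) (w : H) : hinner H (h0 H) w = 0.
Proof.
  pose proof (h_innerDl H (h0 H) (h0 H) w) as E; rewrite h_add0 in E; lra.
Qed.

Lemma h_innerNl (H : HilbertSpace) (x w : H) : hinner H (hopp H x) w = - hinner H x w.
Proof.
  pose proof (h_innerDl H x (hopp H x) w) as E; rewrite h_addN, h_inner0 in E; lra.
Qed.

Lemma hdist_sqr (H : HilbertSpace) (x y : H) :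
  hdist H x y * hdist H x y = hinner H x x + hinner H y y - 2 * hinner H x y.
Proof.
  unfold hdist; rewrite sqrt_sqrt by apply h_innerpos.
  rewrite h_innerDl, h_innerNl, !(h_innerC H _ (hadd H x (hopp H y))), !h_innerDl, !h_innerNl.
  rewrite (h_innerC H y x); ring.
Qed.

Lemma psd_gram {X} (H : HilbertSpace) (v : X -> H) : psd (fun a b => hinner H (v a) (v b)).
Proof.
  split; [intros; apply h_innerC|]; intros y.
  set (vec := fold_right (fun p s => hadd H (hscal H (fst p) (v (snd p))) s) (h0 H)).
  assert (E : forall z w, hinner H (vec z) w = lin (fun a => hinner H (v a) w) z).
  { intros z w; induction z as [|p z IH]; simpl; [apply h_inner0|].
    rewrite h_innerDl, h_innerZl, IH; reflexivity. }
  replace (bil _ y y) with (hinner H (vec y) (vec y)); [apply h_innerpos|].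
  rewrite E; apply lin_ext; intros a; rewrite h_innerC, E.
  apply lin_ext; intros b; apply h_innerC.
Qed.

(** Expanding the squared distance splits off the rank-one kernel [f a * f b] and leaves the
    exponential of a Gram kernel. *)
Lemma psd_gaussian {X} (H : HilbertSpace) (v : X -> H) t : 0 <= t ->
  psd (fun a b => exp (- (t * (hdist H (v a) (v b) * hdist H (v a) (v b))))).
Proof.
  intros Ht; set (f := fun a => exp (- (t * hinner H (v a) (v a)))).
  apply (psd_ext (fun a b => f a * f b * exp ((2 * t) * hinner H (v a) (v b)))).
  - intros a b; unfold f; rewrite <- !exp_plus, hdist_sqr; f_equal; ring.
  - apply psd_mul; [apply psd_tensor|]; apply psd_exp, psd_scal; [lra|apply psd_gram].
Qed.

(** * Positive definite functions *)

Section Group.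
Context {G : Type} (mul : G -> G -> G) (inv : G -> G) (e : G) (HG : is_group G mul inv e).

Lemma inv_unique x y : mul x y = e -> y = inv x.
Proof.
  intros E; rewrite <- (grp_idl _ _ _ _ HG y), <- (grp_invl _ _ _ _ HG x).
  rewrite <- (grp_assoc _ _ _ _ HG), E; apply HG.
Qed.

Lemma inv_inv x : inv (inv x) = x.
Proof. symmetry; apply inv_unique, HG. Qed.

Lemma inv_e : inv e = e.
Proof. symmetry; apply inv_unique, HG. Qed.

Lemma inv_mul x y : inv (mul x y) = mul (inv y) (inv x).
Proof.
  symmetry; apply inv_unique.
  rewrite (grp_assoc _ _ _ _ HG), <- (grp_assoc _ _ _ _ HG x y), (grp_invr _ _ _ _ HG).
  rewrite (grp_idr _ _ _ _ HG); apply HG.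
Qed.

Lemma mulKV x y : mul (inv x) (mul x y) = y.
Proof. rewrite (grp_assoc _ _ _ _ HG), (grp_invl _ _ _ _ HG); apply HG. Qed.

(** Once complex coefficients are split into real and imaginary parts, the cross terms cancel by
    symmetry and two real forms remain. *)
Lemma positive_definite_real (F : G -> R) :
  psd (fun g h => F (mul (inv g) h)) -> positive_definite mul inv (fun g => (F g, 0)).
Proof.
  set (K := fun g h => F (mul (inv g) h)); intros P l.
  set (re := map (fun p : G * Cx => (fst (snd p), fst p))).
  set (im := map (fun p : G * Cx => (snd (snd p), fst p))).
  assert (E1 : forall g c m, Csum (map (fun q => Cmul (Cmul (Cconj c) (snd q))
                 (F (mul (inv g) (fst q)), 0)) m)
               = (fst c * lin (K g) (re m) + snd c * lin (K g) (im m),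
                  fst c * lin (K g) (im m) - snd c * lin (K g) (re m))).
  { intros g c m; induction m as [|q m IH]; simpl.
    - unfold Czero; f_equal; ring.
    - change (fold_right Cadd Czero) with Csum; rewrite IH.
      unfold Cadd, Cmul, Cconj, K; simpl; f_equal; ring. }
  assert (E2 : forall A B m, Csum (map (fun p : G * Cx =>
                 (fst (snd p) * A (fst p) + snd (snd p) * B (fst p),
                  fst (snd p) * B (fst p) - snd (snd p) * A (fst p))) m)
               = (lin A (re m) + lin B (im m), lin B (re m) - lin A (im m))).
  { intros A B m; induction m as [|q m IH]; simpl.
    - unfold Czero; f_equal; ring.
    - change (fold_right Cadd Czero) with Csum; rewrite IH.
      unfold Cadd; simpl; f_equal; ring. }
  cbv zeta.
  rewrite (map_ext _ (fun p : G * Cx =>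
    (fst (snd p) * lin (K (fst p)) (re l) + snd (snd p) * lin (K (fst p)) (im l),
     fst (snd p) * lin (K (fst p)) (im l) - snd (snd p) * lin (K (fst p)) (re l))))
    by (intros; apply E1).
  rewrite (E2 (fun g => lin (K g) (re l)) (fun g => lin (K g) (im l))); simpl; split.
  - change (bil K (re l) (im l) - bil K (im l) (re l) = 0).
    rewrite bil_sym by exact P; ring.
  - change (0 <= bil K (re l) (re l) + bil K (im l) (im l)).
    apply Rplus_le_le_0_compat; apply P.
Qed.

Section PositiveDefinite.
Context (phi : G -> Cx) (P : positive_definite mul inv phi).

(** The form on the two points [e] and [g]; the pointwise relations below come from suitable choices
    of [z] and [w]. *)
Lemma pd_pair g z w :
  let s := Cadd (Cmul (Cmul (Cconj z) z) (phi e))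
          (Cadd (Cmul (Cmul (Cconj z) w) (phi g))
          (Cadd (Cmul (Cmul (Cconj w) z) (phi (inv g)))
                (Cmul (Cmul (Cconj w) w) (phi e)))) in
  snd s = 0 /\ 0 <= fst s.
Proof.
  pose proof (P ((e, z) :: (g, w) :: nil)) as H; simpl in H.
  rewrite inv_e, !(grp_idl _ _ _ _ HG), (grp_invl _ _ _ _ HG), (grp_idr _ _ _ _ HG) in H.
  destruct H as [H1 H2]; split; [rewrite <- H1|eapply Rle_trans; [exact H2|right]];
    unfold Cadd, Cmul, Cconj, Czero; simpl; ring.
Qed.

Lemma pd_e : snd (phi e) = 0 /\ 0 <= fst (phi e).
Proof.
  destruct (pd_pair e (1, 0) (0, 0)) as [H1 H2]; unfold Cadd, Cmul, Cconj in *; simpl in *; lra.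
Qed.

Lemma pd_inv g : fst (phi (inv g)) = fst (phi g) /\ snd (phi (inv g)) = - snd (phi g).
Proof.
  (* The coefficients 1, 1 relate the imaginary parts at [g] and [inv g]; the coefficients 1, i
     relate the real parts. *)
  destruct (pd_pair g (1, 0) (1, 0)) as [H1 _]; destruct (pd_pair g (1, 0) (0, 1)) as [H2 _].
  destruct pd_e as [H3 _]; unfold Cadd, Cmul, Cconj in *; simpl in *; lra.
Qed.

Lemma pd_mod_le g :
  fst (phi g) * fst (phi g) + snd (phi g) * snd (phi g) <= fst (phi e) * fst (phi e).
Proof.
  destruct pd_e as [E1 E2]; destruct (pd_inv g) as [I1 I2].
  set (m := fst (phi g) * fst (phi g) + snd (phi g) * snd (phi g)).
  assert (Hm : 0 <= m) by (unfold m; nra).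
  assert (H : m * m <= fst (phi e) * (m * fst (phi e))).
  { apply discriminant_le; [nra|]; intros t.
    (* With [w] equal to [t] times the conjugate of [phi g], the form is the real quadratic
       [phi e + 2 t m + t^2 m phi e]. *)
    destruct (pd_pair g (1, 0) (t * fst (phi g), - (t * snd (phi g)))) as [_ H].
    unfold Cadd, Cmul, Cconj in H; simpl in H; rewrite E1, I1, I2 in H.
    eapply Rle_trans; [exact H|right]; unfold m; ring. }
  destruct Hm as [Hm|Hm]; [|rewrite <- Hm; nra].
  apply (Rmult_le_reg_l m); lra.
Qed.

Lemma pd_re_le g : - fst (phi e) <= fst (phi g) <= fst (phi e).
Proof. pose proof (pd_mod_le g); destruct pd_e; split; nra. Qed.

(** The squared imaginary part is at most the product of [phi e - Re (phi g)] and
    [phi e + Re (phi g)]. Thus a bound on [phi e - Re phi] also controls the imaginary part. *)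
Lemma pd_im_le g :
  snd (phi g) * snd (phi g) <= 2 * fst (phi e) * (fst (phi e) - fst (phi g)).
Proof. pose proof (pd_mod_le g); pose proof (pd_re_le g); nra. Qed.

Lemma pd_psd_re : psd (fun g h => fst (phi (mul (inv g) h))).
Proof.
  split.
  - intros a b; rewrite <- (proj1 (pd_inv (mul (inv a) b))), inv_mul, inv_inv; reflexivity.
  - intros y.
    destruct (P (map (fun p => (snd p, (fst p, 0))) y)) as [_ H].
    eapply Rle_trans; [exact H|right].
    assert (E : forall (f : G * Cx -> Cx) (h : G -> R) z,
      (forall c g, fst (f (g, (c, 0))) = c * h g) ->
      fst (Csum (map f (map (fun p => (snd p, (fst p, 0))) z))) = lin h z).
    { intros f h z Ef; induction z as [|p z IH]; simpl; [reflexivity|].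
      rewrite Ef, IH; reflexivity. }
    apply E; intros c g; rewrite <- lin_mull; apply E; intros c' g'.
    unfold Cmul, Cconj; simpl; ring.
Qed.

End PositiveDefinite.

(** * Conditionally negative definite functions *)

(** If [psi g] is the squared norm of a cocycle [b g], this is twice the inner product of [b g] and
    [b h]; hence the factor 2 in [K g g = 2 * psi g] below. *)
Definition cnd_kernel (psi : G -> R) (g h : G) : R := psi g + psi h - psi (mul (inv g) h).

Definition cnd (psi : G -> R) : Prop :=
  psi e = 0 /\ (forall g, psi (inv g) = psi g) /\ psd (cnd_kernel psi).

Lemma cnd_pos psi g : cnd psi -> 0 <= psi g.
Proof.
  intros [E [_ [_ P]]]; specialize (P ((1, g) :: nil)); unfold bil, cnd_kernel in P; simpl in P.
  rewrite (grp_invl _ _ _ _ HG), E in P; lra.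
Qed.

Lemma cnd_comb a b f g : 0 <= a -> 0 <= b -> cnd f -> cnd g ->
  cnd (fun x => a * f x + b * g x).
Proof.
  intros Ha Hb [E1 [I1 P1]] [E2 [I2 P2]]; split; [rewrite E1, E2; ring|].
  split; [intros; rewrite I1, I2; reflexivity|].
  apply (psd_ext (fun u v => a * cnd_kernel f u v + b * cnd_kernel g u v)).
  - intros; unfold cnd_kernel; ring.
  - apply psd_comb; assumption.
Qed.

Lemma cnd_zero : cnd (fun _ => 0).
Proof.
  split; [reflexivity|]; split; [reflexivity|].
  apply (psd_ext (fun _ _ => 0 * 0)); [intros; unfold cnd_kernel; ring|].
  apply (psd_tensor (fun _ => 0)).
Qed.

Lemma cnd_scal a f : 0 <= a -> cnd f -> cnd (fun x => a * f x).
Proof.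
  intros Ha Hf; replace (fun x => a * f x) with (fun x => a * f x + 0 * f x).
  - apply cnd_comb; auto; lra.
  - extensionality x; ring.
Qed.

Lemma cnd_cv (f : nat -> G -> R) g :
  (forall n, cnd (f n)) -> (forall x, Un_cv (fun n => f n x) (g x)) -> cnd g.
Proof.
  intros Hf C; split; [|split].
  - apply (UL_sequence (fun n => f n e)); [apply C|].
    intros d Hd; exists 0%nat; intros n _; rewrite (proj1 (Hf n)).
    unfold Rdist; rewrite Rminus_diag, Rabs_R0; exact Hd.
  - intros x; apply (UL_sequence (fun n => f n (inv x))); [apply C|].
    intros d Hd; destruct (C x d Hd) as [N HN]; exists N; intros n Hn.
    rewrite (proj1 (proj2 (Hf n))); auto.
  - apply (psd_cv (fun n => cnd_kernel (f n))); [intros; apply Hf|].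
    intros a b; apply CV_minus; [apply CV_plus|]; apply C.
Qed.

Lemma cnd_of_pd phi : positive_definite mul inv phi ->
  cnd (fun g => fst (phi e) - fst (phi g)).
Proof.
  intros P; pose proof (pd_psd_re phi P) as PR; split; [ring|]; split.
  - intros g; rewrite (proj1 (pd_inv phi P g)); reflexivity.
  - set (R := fun g h => fst (phi (mul (inv g) h))); change (psd R) in PR.
    apply (psd_ext (fun g h => R g h - fst (phi g) - fst (phi h) + fst (phi e)));
      [intros; unfold cnd_kernel, R; ring|].
    split; [intros a b; rewrite (proj1 PR a b); ring|]; intros y.
    set (s := lin (fun _ => 1) y); set (f := lin (fun g => fst (phi g)) y).
    assert (E : bil (fun g h => R g h - fst (phi g) - fst (phi h) + fst (phi e)) y y
                = bil R y y - 2 * s * f + fst (phi e) * s * s).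
    { rewrite (bil_ext _ (fun g h => 1 * (1 * R g h + (-1) * (fst (phi g) * 1)) +
         1 * (fst (phi e) * (1 * 1) + (-1) * (1 * fst (phi h))))) by (intros; ring).
      rewrite !bil_comb, !(bil_tensor (fun _ => 1)), !(bil_tensor _ (fun _ => 1)).
      fold s f; ring. }
    (* Adding the point [e] with weight [- s] makes the weights sum to 0, and the form of [R] on the
       enlarged list is the required one. *)
    rewrite E; pose proof (proj2 PR ((- s, e) :: y)) as H.
    change ((- s, e) :: y) with (((- s, e) :: nil) ++ y) in H.
    rewrite bil_appl, !(bil_appr R) in H by exact PR.
    rewrite (bil_sym R y) in H by exact PR.
    replace (bil R ((- s, e) :: nil) ((- s, e) :: nil)) with (s * s * fst (phi e)) in H.
    2:{ unfold bil, R; simpl; rewrite inv_e, (grp_idl _ _ _ _ HG); ring. }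
    replace (bil R ((- s, e) :: nil) y) with (- s * f) in H; [lra|].
    unfold bil, R; simpl; rewrite Rplus_0_r; f_equal; apply lin_ext; intros h.
    rewrite inv_e, (grp_idl _ _ _ _ HG); reflexivity.
Qed.

(** * The affine action attached to a conditionally negative definite function *)

Section Action.
Context (psi : G -> R) (Hpsi : cnd psi).

Let K := cnd_kernel psi.
Let PK : psd K := proj2 (proj2 Hpsi).

(* Linear extension of [b(h) |-> b(gh) - b(g)], where [b] is the cocycle of the action. *)
Definition translate (g : G) (y : list (R * G)) : list (R * G) :=
  map (fun p => (fst p, mul g (snd p))) y ++ (- lin (fun _ => 1) y, g) :: nil.

Lemma lin_translate f g y : lin f (translate g y) = lin (fun h => f (mul g h) - f g) y.
Proof.
  unfold translate; rewrite lin_app; simpl.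
  induction y as [|p y IH]; simpl; [|rewrite <- IH]; ring.
Qed.

(** For the cocycle [b] with linear part [pi], [b(gh) - b(g) = pi(g) b(h)]; the identity says that
    the adjoint of [pi(g)] is [pi(g^-1)]. *)
Lemma kernel_cocycle g h k :
  K (mul g h) k - K g k = K h (mul (inv g) k) - K h (inv g).
Proof.
  unfold K, cnd_kernel; rewrite inv_mul, (grp_assoc _ _ _ _ HG).
  rewrite <- inv_mul, !(proj1 (proj2 Hpsi)); ring.
Qed.

Lemma kernel_e g : K g e = 0.
Proof.
  unfold K, cnd_kernel; rewrite (grp_idr _ _ _ _ HG), (proj1 (proj2 Hpsi)), (proj1 Hpsi); ring.
Qed.

Lemma bil_translate g x y : bil K (translate g x) y = bil K x (translate (inv g) y).
Proof.
  unfold bil; rewrite lin_translate; apply lin_ext; intros h; rewrite lin_translate.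
  rewrite (lin_ext (fun k => K h (mul (inv g) k) - K h (inv g))
    (fun k => 1 * K (mul g h) k + (-1) * K g k)).
  - rewrite lin_comb; ring.
  - intros k; rewrite <- kernel_cocycle; ring.
Qed.

Lemma nrm_translate g y : nrm K (translate g y) = nrm K y.
Proof.
  unfold nrm; f_equal; rewrite bil_translate; apply lin_ext; intros a.
  rewrite !lin_translate; apply lin_ext; intros h.
  rewrite mulKV, (grp_invl _ _ _ _ HG), kernel_e; ring.
Qed.

(** The linear part is dual to [translate (inv g)]; the translation part [K g], the reproducing
    function at [g], is the image of 0. *)
Definition affine (g : G) (f : G -> R) (h : G) : R :=
  f (mul (inv g) h) - f (inv g) + K g h.

Lemma lin_affine g f y : lin (affine g f) y = lin f (translate (inv g) y) + lin (K g) y.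
Proof. unfold affine; rewrite lin_add, lin_translate; reflexivity. Qed.

Lemma approximable_affine g f : approximable K f -> approximable K (affine g f).
Proof.
  intros A d Hd; destruct (A d Hd) as [x Hx].
  exists (translate g x ++ (1, g) :: nil); intros y.
  rewrite bil_appl, lin_affine, bil_translate, <- (nrm_translate (inv g) y).
  replace (bil K ((1, g) :: nil) y) with (lin (K g) y) by (unfold bil; simpl; ring).
  replace (lin f (translate (inv g) y) + lin (K g) y -
    (bil K x (translate (inv g) y) + lin (K g) y))
    with (lin f (translate (inv g) y) - bil K x (translate (inv g) y)) by ring.
  apply Hx.
Qed.

Definition rk_affine (g : G) (f : rk K) : rk K :=
  exist _ _ (approximable_affine g _ (proj2_sig f)).

(** The point mass at [e] has norm 0, so a function with a dual bound vanishes there. The unit law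
    of the action rests on this. *)
Lemma rk_at_e (f : rk K) : proj1_sig f e = 0.
Proof.
  destruct (approximable_dual_bound K PK _ (proj2_sig f)) as [C [_ HC]].
  specialize (HC ((1, e) :: nil)); rewrite lin_single in HC.
  replace (nrm K ((1, e) :: nil)) with 0 in HC.
  - rewrite Rmult_0_r in HC; apply Rabs_le_bounds in HC; lra.
  - unfold nrm, bil; simpl; rewrite kernel_e, <- sqrt_0 at 1; f_equal; ring.
Qed.

Lemma rk_affine_e f : rk_affine e f = f.
Proof.
  apply rk_eq; intros h; simpl; unfold affine.
  rewrite inv_e, (grp_idl _ _ _ _ HG), rk_at_e, (proj1 PK), kernel_e; ring.
Qed.

Lemma rk_affine_mul g h f : rk_affine (mul g h) f = rk_affine g (rk_affine h f).
Proof.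
  apply rk_eq; intros k; simpl; unfold affine.
  rewrite inv_mul, (grp_assoc _ _ _ _ HG); pose proof (kernel_cocycle g h k); lra.
Qed.

Lemma rk_affine_dist_le g f f' : rk_dist K PK (rk_affine g f) (rk_affine g f') <= rk_dist K PK f f'.
Proof.
  apply rk_dist_le; [apply sqrt_pos|]; intros y; simpl; rewrite !lin_affine.
  rewrite <- (nrm_translate (inv g) y).
  match goal with |- Rabs (?a + ?b - (?c + ?b)) <= _ =>
    replace (a + b - (c + b)) with (a - c) by ring end.
  apply rk_dist_bound.
Qed.

Lemma rk_affine_action :
  affine_isometric_action mul e (rkhs K PK) (rk_affine : G -> rkhs K PK -> rkhs K PK).
Proof.
  split; [apply rk_affine_e|]; split; [apply rk_affine_mul|]; split.
  - intros g f f'; change (rk_dist K PK (rk_affine g f) (rk_affine g f') = rk_dist K PK f f').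
    apply Rle_antisym; [apply rk_affine_dist_le|].
    (* The reverse inequality is the contraction bound for [inv g]. *)
    rewrite <- (rk_affine_e f) at 1; rewrite <- (rk_affine_e f') at 1.
    rewrite <- (grp_invl _ _ _ _ HG g), !rk_affine_mul; apply rk_affine_dist_le.
  - intros g a b f f' Hab; apply rk_eq; intros h; simpl; unfold affine.
    replace b with (1 - a) by lra; ring.
Qed.

Lemma rk_dist_triangle (f g h : rk K) :
  rk_dist K PK f h <= rk_dist K PK f g + rk_dist K PK g h.
Proof.
  apply rk_dist_le; [apply Rplus_le_le_0_compat; apply sqrt_pos|]; intros y.
  replace (lin (proj1_sig f) y - lin (proj1_sig h) y) with
    ((lin (proj1_sig f) y - lin (proj1_sig g) y) +
     (lin (proj1_sig g) y - lin (proj1_sig h) y)) by ring.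
  eapply Rle_trans; [apply Rabs_triang|].
  rewrite Rmult_plus_distr_r; apply Rplus_le_compat; apply rk_dist_bound.
Qed.

Lemma rk_dist_sym (f g : rk K) : rk_dist K PK f g = rk_dist K PK g f.
Proof.
  assert (H : forall f g, rk_dist K PK f g <= rk_dist K PK g f).
  { clear f g; intros f g; apply rk_dist_le; [apply sqrt_pos|]; intros y.
    rewrite Rabs_minus_sym; apply rk_dist_bound. }
  apply Rle_antisym; apply H.
Qed.

(** The image of 0 takes at [g] the value [K g g], the squared norm of the point mass at [g];
    dividing by that norm bounds it by [d]. *)
Lemma psi_le_rk_dist g d : rk_dist K PK (rk_affine g (rk_zero K)) (rk_zero K) <= d ->
  2 * psi g <= d * d.
Proof.
  intros H; assert (Hd : 0 <= d) by (eapply Rle_trans; [apply sqrt_pos|exact H]).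
  pose proof (proj1 (rk_dist_le K PK _ _ d Hd) H ((1, g) :: nil)) as B.
  rewrite !lin_single in B; simpl in B; unfold affine in B.
  assert (E : K g g = 2 * psi g).
  { unfold K, cnd_kernel; rewrite (grp_invl _ _ _ _ HG), (proj1 Hpsi); ring. }
  replace (0 - 0 + K g g - 0) with (nrm K ((1, g) :: nil) * nrm K ((1, g) :: nil)) in B.
  2:{ rewrite (nrm_sqr K PK); unfold bil; simpl; ring. }
  assert (N : nrm K ((1, g) :: nil) * nrm K ((1, g) :: nil) = 2 * psi g).
  { rewrite (nrm_sqr K PK); unfold bil; simpl; rewrite E; ring. }
  pose proof (nrm_pos K ((1, g) :: nil)); apply Rabs_le_bounds in B.
  rewrite <- N; nra.
Qed.

Lemma haagerup_of_proper_cnd :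
  (forall r, finite_pred (fun g => psi g <= r)) -> Haagerup G mul e.
Proof.
  intros Fin; exists (rkhs K PK), rk_affine; split; [apply rk_affine_action|].
  intros B [x0 [r Hr]]; set (o := rk_zero K).
  (* If [x] and its image lie within [r] of [x0], triangle inequalities through [x], its image and
     [x0] bound the displacement of 0 by this [d]. *)
  set (d := 2 * (r + rk_dist K PK x0 o)); destruct (Fin (d * d)) as [l Hl].
  exists l; intros g [x [Bx Bgx]]; apply Hl.
  enough (2 * psi g <= d * d) by (pose proof (cnd_pos psi g Hpsi); lra).
  apply psi_le_rk_dist.
  pose proof (Hr _ Bx) as H1; pose proof (Hr _ Bgx) as H2.
  change (rk_dist K PK x x0 <= r) in H1; change (rk_dist K PK (rk_affine g x) x0 <= r) in H2.
  pose proof (rk_dist_triangle (rk_affine g o) (rk_affine g x) o).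
  pose proof (rk_dist_triangle (rk_affine g x) x0 o).
  pose proof (rk_affine_dist_le g o x).
  pose proof (rk_dist_triangle x x0 o); rewrite (rk_dist_sym o x) in *.
  unfold d; fold o; lra.
Qed.

End Action.
End Group.

(** * Pointwise compactness *)

Lemma choice {A B : Type} (P : A -> B -> Prop) :
  (forall a, exists b, P a b) -> exists f, forall a, P a (f a).
Proof.
  intros H; exists (fun a => proj1_sig (constructive_indefinite_description _ (H a))).
  intros a; destruct constructive_indefinite_description; assumption.
Qed.

Lemma convergent_subsequence (u : nat -> R) b : (forall n, Rabs (u n) <= b) ->
  exists s : nat -> nat, (forall n, (s n < s (S n))%nat) /\ exists l, Un_cv (fun n => u (s n)) l.
Proof.
  intros Hb; destruct (Bolzano_Weierstrass u (fun x => - b <= x <= b) (compact_P3 _ _)) as [l Hl].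
  { intros n; apply Rabs_le_bounds, Hb. }
  assert (H : forall Nk : nat * nat, exists p, (fst Nk <= p)%nat /\
            Rabs (u p - l) < / INR (S (snd Nk))).
  { intros [N k]; apply (Hl (disc l (mkposreal _ (proj1 (inv_INR_S k))))).
    exists (mkposreal _ (proj1 (inv_INR_S k))); intros x Hx; exact Hx. }
  destruct (choice _ H) as [F HF].
  set (s := fix s n := match n with O => F (O, O) | S k => F (S (s k), S k) end).
  exists s; split; [intros n; apply (HF (S (s n), S n))|]; exists l; intros d Hd.
  destruct (inv_INR_small d Hd) as [N HN]; exists N; intros n Hn.
  eapply Rlt_trans; [|apply HN, Hn]; destruct n; apply HF.
Qed.

Lemma increasing_ge (s : nat -> nat) : (forall n, (s n < s (S n))%nat) ->
  forall n, (n <= s n)%nat.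
Proof. intros H n; induction n; [lia|specialize (H n); lia]. Qed.

Lemma diagonal_subsequence (u : nat -> nat -> R) (b : nat -> R) :
  (forall n j, Rabs (u n j) <= b j) ->
  exists D : nat -> nat, (forall k, (k <= D k)%nat) /\
    forall j, exists l, Un_cv (fun k => u (D k) j) l.
Proof.
  intros Hb.
  destruct (choice (fun (sj : (nat -> nat) * nat) (t : nat -> nat) =>
    (forall n, (t n < t (S n))%nat) /\ exists l, Un_cv (fun n => u (fst sj (t n)) (snd sj)) l))
    as [T HT].
  { intros [s j]; apply (convergent_subsequence (fun n => u (s n) j) (b j)); intros; apply Hb. }
  set (s := fix s j := match j with
    | O => T (fun n => n, O)
    | S i => fun n => s i (T (s i, S i) n) end).
  (* Each term of [s (i + j)] occurs in [s j] at least as far along, so from index [j] on the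
     diagonal inherits the convergence of coordinate [j]. *)
  assert (Hs : forall i j k, exists m, (k <= m)%nat /\ s (i + j)%nat k = s j m).
  { induction i as [|i IH]; intros j k; [exists k; split; [lia|reflexivity]|].
    destruct (IH j (T (s (i + j)%nat, S (i + j)) k)) as [m [H1 H2]]; exists m; split.
    - eapply Nat.le_trans; [|exact H1]; apply increasing_ge, HT.
    - exact H2. }
  exists (fun k => s k k); split.
  - intros k; destruct (Hs k O k) as [m [H1 H2]]; rewrite Nat.add_0_r in H2.
    rewrite H2; eapply Nat.le_trans; [exact H1|]; apply increasing_ge, (HT (fun n => n, O)).
  - intros j.
    assert (Hl : exists l, Un_cv (fun n => u (s j n) j) l)
      by (destruct j as [|j]; [apply (HT (fun n => n, O))|apply (HT (s j, S j))]).
    destruct Hl as [l Hl]; exists l; intros d Hd; destruct (Hl d Hd) as [N HN].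
    exists (N + j)%nat; intros k Hk; destruct (Hs (k - j)%nat j k) as [m [H1 H2]].
    replace (k - j + j)%nat with k in H2 by lia; rewrite H2; apply HN; lia.
Qed.

Lemma pointwise_cluster {X : Type} (f : nat -> X -> R) (b : X -> R) :
  countable X -> (forall n x, Rabs (f n x) <= b x) ->
  exists (D : nat -> nat) (g : X -> R), (forall k, (k <= D k)%nat) /\
    forall x, Un_cv (fun k => f (D k) x) (g x).
Proof.
  intros [c Hc] Hb.
  (* Functions on [X] are transported to [nat] along the injection [c], with value 0 off its
     image. *)
  set (pull := fun (h : X -> R) j => match excluded_middle_informative (exists x, c x = j) with
    | left E => h (proj1_sig (constructive_indefinite_description _ E))
    | right _ => 0 end).
  assert (E : forall h x, pull h (c x) = h x).
  { intros h x; unfold pull; destruct excluded_middle_informative as [E|E].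
    - destruct constructive_indefinite_description as [y Hy]; simpl; f_equal; apply Hc, Hy.
    - exfalso; apply E; exists x; reflexivity. }
  destruct (diagonal_subsequence (fun n => pull (f n)) (pull b)) as [D [HD HL]].
  { intros n j; unfold pull; destruct excluded_middle_informative; [apply Hb|].
    rewrite Rabs_R0; apply Rle_refl. }
  destruct (choice _ HL) as [l Hl]; exists D, (fun x => l (c x)); split; [exact HD|].
  intros x d Hd; destruct (Hl (c x) d Hd) as [N HN]; exists N; intros n Hn.
  rewrite <- (E (f (D n))); apply HN, Hn.
Qed.

(** * A minimax argument *)

Definition rsum {X : Type} (f : X -> R) (F : list X) : R := fold_right Rplus 0 (map f F).

Lemma rsum_le {X} (f g : X -> R) F : (forall x, In x F -> f x <= g x) -> rsum f F <= rsum g F.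
Proof.
  unfold rsum; induction F as [|x F IH]; simpl; intros H; [lra|].
  apply Rplus_le_compat; auto.
Qed.

Lemma rsum_ext {X} (f g : X -> R) F : (forall x, In x F -> f x = g x) -> rsum f F = rsum g F.
Proof. intros H; apply Rle_antisym; apply rsum_le; intros x Hx; rewrite (H x Hx); lra. Qed.

Lemma rsum_comb {X} a b (f g : X -> R) F :
  rsum (fun x => a * f x + b * g x) F = a * rsum f F + b * rsum g F.
Proof. unfold rsum; induction F as [|x F IH]; simpl; [ring|rewrite IH; ring]. Qed.

Lemma rsum_scal {X} a (f : X -> R) F : rsum (fun x => a * f x) F = a * rsum f F.
Proof. unfold rsum; induction F as [|x F IH]; simpl; [ring|rewrite IH; ring]. Qed.

Lemma rsum_pos {X} (f : X -> R) F : (forall x, 0 <= f x) -> 0 <= rsum f F.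
Proof.
  intros H; unfold rsum; induction F as [|x F IH]; simpl; [lra|specialize (H x); lra].
Qed.

Lemma rsum_ge_term {X} (f : X -> R) F x : (forall x, 0 <= f x) -> In x F -> f x <= rsum f F.
Proof.
  intros H; unfold rsum; induction F as [|y F IH]; simpl; [tauto|].
  pose proof (rsum_pos f F H) as P; unfold rsum in P; specialize (H y).
  intros [->|I]; [lra|specialize (IH I); lra].
Qed.

Definition pos_part (a : R) : R := Rmax a 0.

Lemma pos_part_ge0 a : 0 <= pos_part a.
Proof. apply Rmax_r. Qed.

Lemma pos_part_ge a : a <= pos_part a.
Proof. apply Rmax_l. Qed.

Lemma pos_part_mul a : pos_part a * a = pos_part a * pos_part a.
Proof. unfold pos_part, Rmax; destruct Rle_dec; nra. Qed.

Lemma pos_part_sqr_shift a h :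
  pos_part (a + h) * pos_part (a + h) <= pos_part a * pos_part a + 2 * pos_part a * h + h * h.
Proof. unfold pos_part, Rmax; destruct (Rle_dec a 0), (Rle_dec (a + h) 0); nra. Qed.

(* Near a minimiser [f] of the squared distance from [C] to the orthant [m <= f], the weights
   [pos_part (m - f)] would separate [C] from that orthant if the distance were positive. *)
Lemma minimax_majorant {X} (C : (X -> R) -> Prop) (F : list X) (m b : R) :
  (exists f, C f) ->
  (forall f g t, 0 <= t <= 1 -> C f -> C g -> C (fun x => (1 - t) * f x + t * g x)) ->
  (forall f x, C f -> In x F -> 0 <= f x <= b) ->
  (forall f, C f -> 0 < rsum (fun x => pos_part (m - f x)) F ->
     exists g, C g /\ rsum (fun x => pos_part (m - f x) * (m - g x)) F <= 0) ->
  forall eta, 0 < eta -> exists f, C f /\ forall x, In x F -> m - eta <= f x.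
Proof.
  intros [f0 Hf0] Conv Bd Sep eta Heta.
  set (d := fun f : X -> R => rsum (fun x => pos_part (m - f x) * pos_part (m - f x)) F).
  assert (d_pos : forall f, 0 <= d f) by (intros; apply rsum_pos; intros; apply Rle_0_sqr).
  (* The infimum of [d] on [C] is [- l], obtained as a supremum of [- d]. *)
  destruct (completeness (fun r => exists f, C f /\ r = - d f)) as [l [Ub Lub]].
  { exists 0; intros r [f [_ ->]]; specialize (d_pos f); lra. }
  { exists (- d f0), f0; auto. }
  assert (Inf : forall f, C f -> - l <= d f).
  { intros f Hf; specialize (Ub (- d f) (ex_intro _ f (conj Hf eq_refl))); lra. }
  assert (Near : forall k, 0 < k -> exists f, C f /\ d f < - l + k).
  { intros k Hk; apply NNPP; intros N.
    assert (l <= l - k); [|lra]; apply Lub; intros r [f [Hf ->]].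
    apply Rnot_lt_le; intros L; apply N; exists f; split; [exact Hf|lra]. }
  assert (Hl : - l <= 0).
  { apply Rnot_lt_le; intros Hl; set (D := rsum (fun _ => b * b) F + 1).
    assert (HD : 0 < D).
    { unfold D; pose proof (rsum_pos (fun _ : X => b * b) F (fun _ => Rle_0_sqr b)); lra. }
    (* Moving by [t] towards the separating [g] gains about [2 t (- l)]. The quadratic error is at
       most [t (- l) / 2], and starting within [t (- l)] of the infimum costs at most that much, so
       the new value falls below the infimum. *)
    set (t := Rmin (/ 2) (- l / (2 * D))).
    assert (Ht : 0 < t) by (apply Rmin_glb_lt; [lra|apply Rdiv_lt_0_compat; lra]).
    assert (Ht1 : t <= / 2) by apply Rmin_l.
    assert (Ht2 : t * D <= - l / 2).
    { replace (- l / 2) with (- l / (2 * D) * D) by (field; lra).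
      apply Rmult_le_compat_r; [lra|apply Rmin_r]. }
    destruct (Near (t * - l)) as [f [Hf Lf]]; [nra|].
    assert (Hs : 0 < rsum (fun x => pos_part (m - f x)) F).
    { apply Rnot_le_lt; intros N; assert (d f <= 0); [|specialize (Inf f Hf); lra].
      unfold d; rewrite (rsum_ext _ (fun _ => 0 * 0)); [rewrite rsum_scal; lra|].
      intros x Hx; cbv beta.
      pose proof (rsum_ge_term (fun x => pos_part (m - f x)) F x (fun _ => pos_part_ge0 _) Hx) as T.
      pose proof (pos_part_ge0 (m - f x)); cbv beta in T.
      replace (pos_part (m - f x)) with 0 by lra; ring. }
    destruct (Sep f Hf Hs) as [g [Hg Lg]].
    set (w := fun x => pos_part (m - f x)).
    assert (S : d (fun x => (1 - t) * f x + t * g x)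
      <= rsum (fun x => 1 * ((1 - 2 * t) * (w x * w x) + 2 * t * (w x * (m - g x))) +
                        t * t * (b * b)) F).
    { apply rsum_le; intros x Hx.
      replace (m - ((1 - t) * f x + t * g x)) with ((m - f x) + t * (f x - g x)) by ring.
      eapply Rle_trans; [apply pos_part_sqr_shift|]; fold (w x).
      pose proof (pos_part_mul (m - f x)) as E; fold (w x) in E.
      assert (w x * w x + 2 * w x * (t * (f x - g x)) =
        (1 - 2 * t) * (w x * w x) + 2 * t * (w x * (m - g x))) by (rewrite <- E; ring).
      pose proof (Bd f x Hf Hx); pose proof (Bd g x Hg Hx).
      assert ((f x - g x) * (f x - g x) <= b * b).
      { apply Rsqr_le_abs_1; rewrite (Rabs_right b) by lra; apply Rabs_le; lra. }
      assert (t * t * ((f x - g x) * (f x - g x)) <= t * t * (b * b))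
        by (apply Rmult_le_compat_l; [apply Rle_0_sqr|assumption]).
      lra. }
    rewrite !rsum_comb in S.
    change (rsum (fun x => w x * w x) F) with (d f) in S.
    change (rsum (fun x => w x * (m - g x)) F <= 0) in Lg.
    assert (Hc : C (fun x => (1 - t) * f x + t * g x)) by (apply Conv; auto; lra).
    specialize (Inf _ Hc).
    assert (t * t * rsum (fun _ => b * b) F <= t * (- l / 2)).
    { rewrite Rmult_assoc; apply Rmult_le_compat_l; [lra|].
      apply Rle_trans with (t * D); [|exact Ht2]; apply Rmult_le_compat_l; [lra|unfold D; lra]. }
    assert (2 * t * rsum (fun x => w x * (m - g x)) F <= 0) by nra.
    assert ((1 - 2 * t) * d f <= (1 - 2 * t) * (- l + t * - l))
      by (apply Rmult_le_compat_l; lra).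
    assert (0 < t * - l) by nra.
    nra. }
  destruct (Near (eta * eta)) as [f [Hf Lf]]; [nra|]; exists f; split; [exact Hf|].
  intros x Hx; pose proof (pos_part_ge (m - f x)); apply Rnot_lt_le; intros N.
  pose proof (rsum_ge_term (fun x => pos_part (m - f x) * pos_part (m - f x)) F x
    (fun _ => Rle_0_sqr _) Hx) as T; cbv beta in T; fold (d f) in T.
  nra.
Qed.

Lemma finite_pred_enum {X} (P : X -> Prop) :
  finite_pred P -> exists F, NoDup F /\ forall x, In x F <-> P x.
Proof.
  intros [l Hl].
  exists (nodup (fun x y => excluded_middle_informative (x = y))
    (filter (fun x => if excluded_middle_informative (P x) then true else false) l)).
  split; [apply NoDup_nodup|]; intros x; rewrite nodup_In, filter_In.
  destruct (excluded_middle_informative (P x)) as [p|np].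
  - split; [intros _; exact p|split; [apply Hl, p|reflexivity]].
  - split; [intros [_ H]; discriminate|contradiction].
Qed.

(** * The two implications *)

Section Main.
Context {G : Type} (mul : G -> G -> G) (inv : G -> G) (e : G) (HG : is_group G mul inv e).
Context (Hcount : countable G).
Context (L0 : G -> R) (HL : length_function mul inv e L0) (Hprop : proper_length L0).

Definition dominated_cnd (psi : G -> R) : Prop :=
  cnd mul inv e psi /\ forall g, psi g <= 1 + L0 g.

Definition symmetric_finprob_beyond (n : nat) (mu : G -> R) (S : list G) : Prop :=
  finprob mu S /\ symmetric_measure inv mu /\ forall g, In g S -> INR n <= L0 g.

Lemma dominated_cnd_convex f g t : 0 <= t <= 1 -> dominated_cnd f -> dominated_cnd g ->
  dominated_cnd (fun x => (1 - t) * f x + t * g x).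
Proof.
  intros Ht [Cf Bf] [Cg Bg]; split; [apply cnd_comb; auto; lra|]; intros x.
  specialize (Bf x); specialize (Bg x); nra.
Qed.

Lemma dominated_cnd_cluster (f : nat -> G -> R) : (forall n, dominated_cnd (f n)) ->
  exists (D : nat -> nat) psi, (forall k, (k <= D k)%nat) /\ dominated_cnd psi /\
    forall g, Un_cv (fun k => f (D k) g) (psi g).
Proof.
  intros Hf; destruct (pointwise_cluster f (fun g => 1 + L0 g) Hcount) as [D [psi [HD Hpsi]]].
  { intros n x; rewrite Rabs_right; [apply Hf|]; apply Rle_ge, (cnd_pos mul inv e HG), Hf. }
  exists D, psi; split; [exact HD|]; split; [|exact Hpsi]; split.
  - apply (cnd_cv mul inv e (fun k => f (D k))); [intros; apply Hf|exact Hpsi].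
  - intros g; apply (Un_cv_le (fun k => f (D k) g) (fun _ => 1 + L0 g));
      [apply Hpsi|apply Un_cv_const|]; exists O; intros; apply Hf.
Qed.

(** The minimax weights, normalised by their sum, form a probability measure on [F], symmetric
    because both [f] and [F] are invariant under inversion. The loss of 1 is the tolerance [eta]. *)
Lemma majorant_on_finite n m F :
  (forall mu S, symmetric_finprob_beyond n mu S ->
     exists psi, dominated_cnd psi /\ m < rsum (fun g => mu g * psi g) S) ->
  NoDup F -> (forall g, In g F -> INR n <= L0 g) -> (forall g, In g F -> In (inv g) F) ->
  exists psi, dominated_cnd psi /\ forall g, In g F -> m - 1 <= psi g.
Proof.
  intros Sep ND Hn Hinv.
  assert (Hb : exists b, forall g, In g F -> 1 + L0 g <= b).
  { exists (rsum (fun g => 1 + L0 g) F); intros g Hg.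
    apply (rsum_ge_term (fun g => 1 + L0 g)); [|exact Hg].
    intros x; pose proof (proj1 HL x); lra. }
  destruct Hb as [b Hb]; apply (minimax_majorant dominated_cnd F m b); [| | | |lra].
  - exists (fun _ => 0); split; [apply cnd_zero|]; intros g; pose proof (proj1 HL g); lra.
  - intros; apply dominated_cnd_convex; assumption.
  - intros f g [Cf Bf] Hg; split; [apply (cnd_pos mul inv e HG _ _ Cf)|].
    eapply Rle_trans; [apply Bf|apply Hb, Hg].
  - intros f [Cf Bf] Hs; set (s := rsum (fun x => pos_part (m - f x)) F) in *.
    set (mu := fun g => if excluded_middle_informative (In g F) then pos_part (m - f g) / s else 0).
    assert (Emu : forall g, In g F -> mu g = / s * pos_part (m - f g)).
    { intros g Hg; unfold mu; destruct excluded_middle_informative; [field; lra|tauto]. }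
    destruct (Sep mu F) as [psi [Hpsi L]].
    + repeat split; auto.
      * intros g; unfold mu; destruct excluded_middle_informative; [|lra].
        apply Rmult_le_pos; [apply pos_part_ge0|left; apply Rinv_0_lt_compat, Hs].
      * intros g; unfold mu; destruct excluded_middle_informative; tauto.
      * change (rsum mu F = 1); rewrite (rsum_ext _ _ _ Emu), rsum_scal; fold s; field; lra.
      * intros g; unfold mu; rewrite (proj1 (proj2 Cf)).
        assert (In (inv g) F <-> In g F).
        { split; [|apply Hinv]; intros H; rewrite <- (inv_inv mul inv e HG g); apply Hinv, H. }
        destruct (excluded_middle_informative (In (inv g) F)),
          (excluded_middle_informative (In g F)); tauto.
    + exists psi; split; [exact Hpsi|].
      rewrite (rsum_ext _ (fun g => / s * (pos_part (m - f g) * psi g))) in L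
        by (intros g Hg; rewrite (Emu g Hg); ring).
      rewrite rsum_scal in L; apply (Rmult_lt_compat_l s) in L; [|exact Hs].
      rewrite <- Rmult_assoc, Rinv_r, Rmult_1_l in L by lra.
      rewrite (rsum_ext _ (fun g => m * pos_part (m - f g) + (-1) * (pos_part (m - f g) * psi g)))
        by (intros; ring).
      rewrite rsum_comb; fold s; lra.
Qed.

(** The region is exhausted by the finite shells [INR n <= L0 g <= INR N], closed under inversion; a
    cluster point of the majorants on the shells works on all of them. *)
Lemma majorant_beyond n m :
  (forall mu S, symmetric_finprob_beyond n mu S ->
     exists psi, dominated_cnd psi /\ m < rsum (fun g => mu g * psi g) S) ->
  exists psi, dominated_cnd psi /\ forall g, INR n <= L0 g -> m - 1 <= psi g.
Proof.
  intros Sep.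
  assert (H : forall N : nat, exists psi, dominated_cnd psi /\
    forall g, INR n <= L0 g <= INR N -> m - 1 <= psi g).
  { intros N; destruct (finite_pred_enum (fun g => INR n <= L0 g <= INR N)) as [F [ND HF]].
    { destruct (Hprop (INR N)) as [l Hl]; exists l; intros g Hg; apply Hl, Hg. }
    destruct (majorant_on_finite n m F Sep ND) as [psi [H1 H2]].
    - intros g Hg; apply HF, Hg.
    - intros g Hg; apply HF; rewrite (proj2 (proj2 (proj2 HL))); apply HF, Hg.
    - exists psi; split; [exact H1|]; intros g Hg; apply H2, HF, Hg. }
  destruct (choice _ H) as [f Hf].
  destruct (dominated_cnd_cluster f) as [D [psi [HD [Hpsi C]]]]; [intros; apply Hf|].
  exists psi; split; [exact Hpsi|]; intros g Hg; destruct (INR_unbounded (L0 g)) as [N HN].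
  apply (Un_cv_le (fun _ => m - 1) (fun k => f (D k) g)); [apply Un_cv_const|apply C|].
  exists N; intros k Hk; apply Hf; split; [exact Hg|].
  apply Rle_trans with (INR N); [lra|]; apply le_INR; specialize (HD k); lia.
Qed.

(* The sum of the [2 ^ -(k+1) f k] is proper when [f k] exceeds [k 2 ^ (k+1)] off a finite set;
   its value is obtained as a cluster point of the partial sums. *)
Lemma haagerup_of_majorants :
  (forall m, exists n psi, dominated_cnd psi /\ forall g, INR n <= L0 g -> m <= psi g) ->
  Haagerup G mul e.
Proof.
  intros H.
  destruct (choice (fun k (np : nat * (G -> R)) => dominated_cnd (snd np) /\
    forall g, INR (fst np) <= L0 g -> INR k * 2 ^ S k <= snd np g)) as [F HF].
  { intros k; destruct (H (INR k * 2 ^ S k)) as [n [psi Hn]]; exists (n, psi); exact Hn. }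
  set (psum := fix psum N (g : G) := match N with
    | O => 0
    | S k => 1 * psum k g + / 2 ^ S k * snd (F k) g end).
  assert (P2 : forall k, 0 < / 2 ^ k) by (intros; apply Rinv_0_lt_compat, pow_lt; lra).
  assert (Cnd : forall N, cnd mul inv e (psum N)).
  { induction N as [|N IH]; [apply cnd_zero|].
    change (cnd mul inv e (fun g => 1 * psum N g + / 2 ^ S N * snd (F N) g)).
    apply cnd_comb; [lra|left; apply P2|exact IH|apply HF]. }
  (* The first [N] weights add up to [1 - / 2 ^ N], so partial sums stay dominated and compactness
     applies. *)
  assert (Dom : forall N g, psum N g <= (1 - / 2 ^ N) * (1 + L0 g)).
  { induction N as [|N IH]; intros g; [simpl; lra|].
    change (1 * psum N g + / 2 ^ S N * snd (F N) g <= (1 - / 2 ^ S N) * (1 + L0 g)).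
    pose proof (proj2 (proj1 (HF N)) g) as B; specialize (IH g).
    apply (Rmult_le_compat_l (/ 2 ^ S N)) in B; [|left; apply P2].
    assert (/ 2 ^ N = 2 * / 2 ^ S N) by (simpl; field; apply pow_nonzero; lra).
    nra. }
  assert (Big : forall N k g, (k < N)%nat -> INR (fst (F k)) <= L0 g -> INR k <= psum N g).
  { intros N k g Hk Hg; induction N as [|N IH]; [lia|].
    change (INR k <= 1 * psum N g + / 2 ^ S N * snd (F N) g).
    pose proof (cnd_pos mul inv e HG _ g (proj1 (proj1 (HF N)))) as Hp.
    apply (Rmult_le_compat_l (/ 2 ^ S N)) in Hp; [|left; apply P2].
    rewrite Rmult_0_r in Hp; destruct (Nat.eq_dec k N) as [->|Ne].
    - pose proof (cnd_pos mul inv e HG _ g (Cnd N)); pose proof (proj2 (HF N) g Hg) as B.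
      apply (Rmult_le_compat_l (/ 2 ^ S N)) in B; [|left; apply P2].
      replace (/ 2 ^ S N * (INR N * 2 ^ S N)) with (INR N) in B
        by (field; apply pow_nonzero; lra).
      lra.
    - specialize (IH ltac:(lia)); lra. }
  destruct (dominated_cnd_cluster psum) as [D [psi [HD [Hpsi C]]]].
  { intros N; split; [apply Cnd|]; intros g; specialize (Dom N g).
    pose proof (P2 N); pose proof (proj1 HL g); nra. }
  apply (haagerup_of_proper_cnd mul inv e HG psi (proj1 Hpsi)); intros r.
  destruct (INR_unbounded r) as [k Hk]; destruct (Hprop (INR (fst (F k)))) as [l Hl].
  exists l; intros g Hg; apply Hl, Rnot_lt_le; intros Lt.
  assert (INR k <= psi g); [|lra].
  apply (Un_cv_le (fun _ => INR k) (fun j => psum (D j) g)); [apply Un_cv_const|apply C|].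
  exists (S k); intros j Hj; apply Big; [specialize (HD j); lia|lra].
Qed.

(** * From bounded means to relative property T *)

Lemma Expect_fst (mu : G -> R) S f : fst (Expect mu S f) = rsum (fun g => mu g * fst (f g)) S.
Proof.
  unfold Expect, rsum; induction S as [|g S IH]; simpl; [reflexivity|].
  f_equal; exact IH.
Qed.

Lemma Expect_snd (mu : G -> R) S f : snd (Expect mu S f) = rsum (fun g => mu g * snd (f g)) S.
Proof.
  unfold Expect, rsum; induction S as [|g S IH]; simpl; [reflexivity|].
  f_equal; exact IH.
Qed.

Lemma Cmod_le z : Cmod z <= Rabs (fst z) + Rabs (snd z).
Proof.
  unfold Cmod; pose proof (Rabs_pos (fst z)); pose proof (Rabs_pos (snd z)).
  rewrite <- (sqrt_Rsqr (Rabs (fst z) + Rabs (snd z))) by lra.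
  apply sqrt_le_1; [nra|apply Rle_0_sqr|]; unfold Rsqr.
  pose proof (Rsqr_abs (fst z)); pose proof (Rsqr_abs (snd z)); unfold Rsqr in *; nra.
Qed.

Lemma fst_le_Cmod z : Rabs (fst z) <= Cmod z.
Proof.
  unfold Cmod; rewrite <- sqrt_Rsqr_abs; apply sqrt_le_1; unfold Rsqr; nra.
Qed.

(** Where [L0 g] exceeds [4 / eta], the difference is at most [2 * phi e], hence below 4 once
    [phi e < 2]. On the finitely many remaining points it is eventually at most [eta], by pointwise
    convergence. *)
Lemma eventually_dominated (phi : nat -> G -> Cx) :
  (forall k, positive_definite mul inv (phi k)) ->
  (forall g, Un_cv (fun k => fst (phi k g)) 1) ->
  forall eta, 0 < eta -> exists K, forall k, (k >= K)%nat ->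
    Rabs (fst (phi k e) - 1) < eta /\
    dominated_cnd (fun g => / eta * (fst (phi k e) - fst (phi k g))).
Proof.
  intros P C eta He; destruct (Hprop (4 / eta)) as [l Hl].
  assert (Fin : exists K, forall k, (k >= K)%nat -> forall g, In g l ->
    fst (phi k e) - fst (phi k g) <= eta).
  { clear Hl; induction l as [|g l [K IH]]; [exists O; intros k _ g []|].
    destruct (C e (eta / 2)) as [K1 H1]; [lra|]; destruct (C g (eta / 2)) as [K2 H2]; [lra|].
    exists (K + K1 + K2)%nat; intros k Hk x [<-|Hx]; [|apply IH; [lia|exact Hx]].
    specialize (H1 k ltac:(lia)); specialize (H2 k ltac:(lia)).
    unfold Rdist in *; apply Rabs_def2 in H1; apply Rabs_def2 in H2; lra. }
  destruct Fin as [K HK]; destruct (C e eta) as [K1 H1]; [lra|].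
  destruct (C e 1) as [K2 H2]; [lra|].
  exists (K + K1 + K2)%nat; intros k Hk; split; [apply H1; lia|].
  assert (He' : 0 < / eta) by (apply Rinv_0_lt_compat, He).
  split; [apply cnd_scal; [left; exact He'|apply (cnd_of_pd mul inv e HG), P]|].
  intros g; pose proof (proj1 HL g); apply (Rmult_le_reg_l eta); [exact He|].
  rewrite <- Rmult_assoc, Rinv_r, Rmult_1_l by lra.
  destruct (Rle_lt_dec (L0 g) (4 / eta)) as [Le|Lt].
  - specialize (HK k ltac:(lia) g (Hl g Le)); nra.
  - specialize (H2 k ltac:(lia)); unfold Rdist in H2; apply Rabs_def2 in H2.
    pose proof (pd_re_le mul inv e HG _ (P k) g).
    apply (Rmult_lt_compat_l eta) in Lt; [|exact He].
    replace (eta * (4 / eta)) with 4 in Lt by (field; lra); lra.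
Qed.

Lemma relative_T_of_bounded m mu S :
  (forall n, symmetric_finprob_beyond n (mu n) (S n)) ->
  (forall n psi, dominated_cnd psi -> rsum (fun g => mu n g * psi g) (S n) <= m) ->
  relative_T mul inv mu S.
Proof.
  intros Hmu Hm phi P C eps Heps.
  assert (m0 : 0 <= m).
  { specialize (Hm O (fun _ => 0)).
    rewrite (rsum_ext _ (fun _ => 0 * 0)), rsum_scal, Rmult_0_l in Hm by (intros; ring).
    apply Hm; split; [apply cnd_zero|]; intros g; pose proof (proj1 HL g); lra. }
  (* The total error will be at most [eta * q + eps / 4]: [eta * (1 + m)] from the real part, the
     rest from the imaginary part. *)
  set (q := 1 + m * (1 + 4 / eps)).
  assert (Hq : 0 < q).
  { assert (0 < 4 / eps) by (apply Rdiv_lt_0_compat; lra); unfold q; nra. }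
  (* The bound 1 keeps [phi k e] below 2, which turns [pd_im_le] into a bound by [4 * psi]. *)
  set (eta := Rmin 1 (eps / (4 * q))).
  assert (He : 0 < eta) by (apply Rmin_glb_lt; [lra|apply Rdiv_lt_0_compat; lra]).
  assert (He1 : eta <= 1) by apply Rmin_l.
  assert (He2 : eta * q <= eps / 4).
  { replace (eps / 4) with (eps / (4 * q) * q) by (field; lra).
    apply Rmult_le_compat_r; [lra|apply Rmin_r]. }
  destruct (eventually_dominated phi P (fun g => proj1 (C g)) eta He) as [K HK].
  exists K; intros k n Hk; destruct (HK k Hk) as [H1 H2].
  set (c := fst (phi k e)) in *; set (psi := fun g => c - fst (phi k g)).
  destruct (Hmu n) as [[_ [mu0 [_ mu1]]] _]; change (rsum (mu n) (S n) = 1) in mu1.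
  set (E := rsum (fun g => mu n g * psi g) (S n)).
  assert (E0 : 0 <= E).
  { apply rsum_pos; intros g; apply Rmult_le_pos; [apply mu0|].
    apply (cnd_pos mul inv e HG), (cnd_of_pd mul inv e HG), P. }
  assert (E1 : E <= eta * m).
  { specialize (Hm n _ H2).
    rewrite (rsum_ext _ (fun g => / eta * (mu n g * psi g))), rsum_scal in Hm
      by (intros; unfold psi; ring).
    fold E in Hm; apply (Rmult_le_compat_l eta) in Hm; [|lra].
    rewrite <- Rmult_assoc, Rinv_r, Rmult_1_l in Hm by lra; exact Hm. }
  eapply Rle_lt_trans; [apply Cmod_le|]; unfold Cadd; simpl.
  rewrite Expect_fst, Expect_snd, Rplus_0_r.
  assert (A1 : rsum (fun g => mu n g * fst (phi k g)) (S n) = c - E).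
  { rewrite (rsum_ext _ (fun g => c * mu n g + (-1) * (mu n g * psi g)))
      by (intros; unfold psi; ring).
    rewrite rsum_comb, mu1; unfold E; ring. }
  rewrite A1; apply Rabs_def2 in H1.
  assert (A2 : Rabs (c - E + -1) <= eta + eta * m) by (apply Rabs_le; lra).
  (* AM-GM: [|Im phi| <= (2/eps) (Im phi)^2 / 2 + eps/4], and [(Im phi)^2 <= 2 c psi]. *)
  assert (Im : forall g, Rabs (snd (phi k g)) <= eps / 4 + 4 / eps * psi g).
  { intros g; pose proof (pd_im_le mul inv e HG _ (P k) g) as I; fold c in I.
    change (c - fst (phi k g)) with (psi g) in I.
    assert (Hp : 0 <= psi g)
      by (apply (cnd_pos mul inv e HG), (cnd_of_pd mul inv e HG), P).
    apply (Rmult_le_reg_l eps); [lra|].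
    replace (eps * (eps / 4 + 4 / eps * psi g)) with (eps * eps / 4 + 4 * psi g)
      by (field; lra).
    assert (Hs : Rabs (snd (phi k g)) * Rabs (snd (phi k g)) <= 4 * psi g).
    { rewrite <- Rabs_mult, Rabs_right by (apply Rle_ge, Rle_0_sqr); nra. }
    pose proof (Rle_0_sqr (eps / 2 - Rabs (snd (phi k g)))) as Sq; unfold Rsqr in Sq; nra. }
  assert (A3 : Rabs (rsum (fun g => mu n g * snd (phi k g)) (S n)) <=
    eps / 4 + 4 / eps * E).
  { assert (B : rsum (fun g => mu n g * Rabs (snd (phi k g))) (S n) <= eps / 4 + 4 / eps * E).
    { apply Rle_trans with (rsum (fun g => eps / 4 * mu n g + 4 / eps * (mu n g * psi g)) (S n)).
      - apply rsum_le; intros g _; specialize (Im g).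
        apply (Rmult_le_compat_l (mu n g)) in Im; [lra|apply mu0].
      - rewrite rsum_comb, mu1; fold E; lra. }
    eapply Rle_trans; [|exact B]; apply Rabs_le; split.
    - rewrite <- (Rmult_1_l (rsum _ _)), <- Ropp_mult_distr_l_reverse, <- rsum_scal.
      apply rsum_le; intros g _; specialize (mu0 g).
      pose proof (Rle_abs (- snd (phi k g))); rewrite Rabs_Ropp in *; nra.
    - apply rsum_le; intros g _; apply Rmult_le_compat_l; [apply mu0|apply Rle_abs]. }
  assert (4 / eps * E <= 4 / eps * (eta * m)).
  { apply Rmult_le_compat_l; [left; apply Rdiv_lt_0_compat; lra|exact E1]. }
  unfold q in He2; lra.
Qed.

Lemma relative_T_of_not_haagerup : ~ Haagerup G mul e ->
  exists (mu : nat -> G -> R) (S : nat -> list G),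
    (forall n, symmetric_finprob_beyond n (mu n) (S n)) /\ relative_T mul inv mu S.
Proof.
  intros NH; apply NNPP; intros N; apply NH, haagerup_of_majorants; intros m.
  apply NNPP; intros N1; apply N.
  destruct (choice (fun n (muS : (G -> R) * list G) =>
    symmetric_finprob_beyond n (fst muS) (snd muS) /\
    forall psi, dominated_cnd psi -> rsum (fun g => fst muS g * psi g) (snd muS) <= m + 1))
    as [F HF].
  - intros n; apply NNPP; intros N2; apply N1; exists n.
    replace m with (m + 1 - 1) by ring; apply majorant_beyond; intros mu S HS.
    apply NNPP; intros N3; apply N2; exists (mu, S); split; [exact HS|].
    intros psi Hpsi; apply Rnot_lt_le; intros Lt; apply N3; exists psi; split; assumption.
  - exists (fun n => fst (F n)), (fun n => snd (F n)); split; [intros; apply HF|].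
    apply (relative_T_of_bounded (m + 1)); intros; apply HF; assumption.
Qed.

Lemma not_haagerup_of_relative_T mu S :
  (forall n, symmetric_finprob_beyond n (mu n) (S n)) -> relative_T mul inv mu S ->
  ~ Haagerup G mul e.
Proof.
  intros Hmu T [H [alpha [[Ae [Am [Ai _]]] Pr]]].
  set (v := fun g => alpha g (h0 H)).
  set (psi := fun g => hdist H (v g) (h0 H) * hdist H (v g) (h0 H)).
  (* Applying the isometry of [inv g] carries [v g] to 0 and [v h] to [v (mul (inv g) h)]. *)
  assert (D : forall g h, hdist H (v g) (v h) * hdist H (v g) (v h) = psi (mul (inv g) h)).
  { intros g h; unfold psi; rewrite <- (Ai (inv g) (v g) (v h)).
    unfold v; rewrite <- !Am, (grp_invl _ _ _ _ HG), Ae.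
    rewrite !hdist_sqr, (h_innerC H (h0 H) (alpha _ _)); ring. }
  set (phi := fun (k : nat) g => (exp (- (/ INR (Datatypes.S k) * psi g)), 0) : Cx).
  destruct (T phi) with (eps := / 2) as [K HK]; [| |lra|].
  - intros k; apply positive_definite_real.
    apply (psd_ext (fun g h =>
      exp (- (/ INR (Datatypes.S k) * (hdist H (v g) (v h) * hdist H (v g) (v h)))))).
    + intros g h; rewrite D; reflexivity.
    + apply psd_gaussian; left; apply inv_INR_S.
  - intros g; split; [|apply (Un_cv_const 0)].
    rewrite <- exp_0; apply (continuity_seq exp (fun k => - (/ INR (Datatypes.S k) * psi g)) 0).
    + apply derivable_continuous_pt, derivable_pt_exp.
    + intros d Hd; assert (Hq : 0 < psi g + 1)
        by (unfold psi; pose proof (Rle_0_sqr (hdist H (v g) (h0 H))); unfold Rsqr in *; lra).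
      destruct (inv_INR_small (d / (psi g + 1))) as [N HN]; [apply Rdiv_lt_0_compat; lra|].
      exists N; intros k Hk; specialize (HN k Hk); pose proof (inv_INR_S k).
      unfold Rdist; rewrite Rminus_0_r, Rabs_Ropp, Rabs_right.
      * apply (Rmult_lt_compat_r (psi g + 1)) in HN; [|exact Hq].
        replace (d / (psi g + 1) * (psi g + 1)) with d in HN by (field; lra); nra.
      * apply Rle_ge, Rmult_le_pos; [lra|apply Rle_0_sqr].
  (* Only the function of index [K] is used: if [v g] has norm above [r], then [t * psi g >= 1] and
     the exponential is at most [/ 2]. *)
  - set (r := INR (Datatypes.S K)); set (t := / r).
    assert (Hr : 1 <= r) by (unfold r; rewrite S_INR; pose proof (pos_INR K); lra).
    assert (Ht : 0 < t) by (apply Rinv_0_lt_compat; lra).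
    destruct (Pr (fun x => hdist H x (h0 H) <= r)) as [l Hl].
    { exists (h0 H), r; auto. }
    (* This [n] exceeds [L0] on all of [l], so the support of [mu n] avoids the group elements
       moving 0 by at most [r]. *)
    destruct (INR_unbounded (rsum L0 l)) as [n Hn].
    destruct (Hmu n) as [[_ [mu0 [_ mu1]]] [_ Hsup]]; change (rsum (mu n) (S n) = 1) in mu1.
    assert (Small : forall g, In g (S n) -> exp (- (t * psi g)) <= / 2).
    { intros g Hg; assert (Far : r < hdist H (v g) (h0 H)).
      { apply Rnot_le_lt; intros Le; assert (Ig : In g l).
        - apply Hl; exists (h0 H); split; [|exact Le].
          unfold hdist; rewrite h_addN, h_inner0, sqrt_0; lra.
        - pose proof (rsum_ge_term L0 l g (proj1 HL) Ig); specialize (Hsup g Hg); lra. }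
      assert (1 <= t * psi g).
      { apply Rle_trans with (t * (r * r)); [|apply Rmult_le_compat_l; [lra|unfold psi; nra]].
        unfold t; rewrite <- Rmult_assoc, Rinv_l by lra; lra. }
      rewrite exp_Ropp; apply Rinv_le_contravar; [lra|].
      pose proof (exp_ineq1_le (t * psi g)); lra. }
    specialize (HK K n (Nat.le_refl _)).
    apply (Rle_lt_trans _ _ _ (fst_le_Cmod _)) in HK; unfold Cadd in HK; simpl fst in HK.
    rewrite Expect_fst in HK.
    assert (rsum (fun g => mu n g * fst (phi K g)) (S n) <= / 2).
    { apply Rle_trans with (rsum (fun g => / 2 * mu n g) (S n)).
      - apply rsum_le; intros g Hg; specialize (Small g Hg); specialize (mu0 g).
        change (mu n g * exp (- (t * psi g)) <= / 2 * mu n g); nra.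
      - rewrite rsum_scal, mu1; lra. }
    apply Rabs_def2 in HK; lra.
Qed.

End Main.

Theorem mainTheorem5 (G : Type) (mul : G -> G -> G) (inv : G -> G) (e : G)
  (HG : is_group G mul inv e) (Hcount : countable G)
  (L0 : G -> R) (HL : length_function mul inv e L0) (Hprop : proper_length L0) :
  ~ Haagerup G mul e <->
  exists (mu : nat -> G -> R) (S : nat -> list G),
    (forall n, finprob (mu n) (S n) /\ symmetric_measure inv (mu n) /\
               (forall g, In g (S n) -> INR n <= L0 g)) /\
    relative_T mul inv mu S.
Proof.
  split.
  - apply (relative_T_of_not_haagerup mul inv e HG Hcount L0 HL Hprop).
  - intros [mu [S [Hmu T]]].
    apply (not_haagerup_of_relative_T mul inv e HG L0 HL mu S Hmu T).
Qed.
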